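(* Let $\Gamma_1(z)=C_1z+D_1$ and $\Gamma_2(z)=C_2z+D_2$ ($z\in\mathbb{C}^n$) for some $C_1,C_2\in\mathcal{M}(n)$ with $\|C_1\|\le 1$, $\|C_2\|\le 1$ and $D_1,D_2\in\mathbb{C}^n$, such that the composition operators $C_{\Gamma_1}$ and $C_{\Gamma_2}$ are bounded on $F_\psi^2$. Then the adjoint of $C_{\Gamma_1}$ is the composition operator $C_{\Gamma_2}$, i.e. $C_{\Gamma_1}^*=C_{\Gamma_2}$, if and only if $$D_1=0,\quad D_2=0\quad\text{and}\quad C_1^*=C_2.$$
   Context: Let $n\ge 1$. On $\mathbb{C}^n$ write $\langle w,z\rangle=\sum_{j=1}^n w_j\overline{z_j}$ and $|w|^2=\langle w,w\rangle$. $\mathcal{M}(n)$ is the set of complex $n\times n$ matrices, $\|C\|$ is the operator norm of $C$ induced by $|\cdot|$, and $C^*$ is the conjugate transpose. Weight: $\psi:[0,\infty)\to[0,\infty)$ is a $C^3$ function with $\psi'(y)>0$, $\psi''(y)\ge 0$, $\psi'''(y)\ge 0$ for all $y\ge 0$. Moreover there is a real number $l<\tfrac12$ such that, with $\phi(y)=y\psi'(y)$, $\phi''(y)=O\big(y^{-1/2}[\phi'(y)]^{1+l}\big)$ as $y\to\infty$; when $n>1$ it is also assumed that $\psi''(y)=O\big(y^{-1/2}[\psi'(y)]^{1+l}\big)$ as $y\to\infty$. Space: $F_\psi^2$ is the Hilbert space of holomorphic functions $g:\mathbb{C}^n\to\mathbb{C}$ with $\int_{\mathbb{C}^n}|g(z)|^2e^{-\psi(|z|^2)}\,d\mu(z)<\infty$,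 with inner product $\langle g,h\rangle_\psi=\int_{\mathbb{C}^n} g(z)\overline{h(z)}e^{-\psi(|z|^2)}\,d\mu(z)$, where $\mu$ is Lebesgue measure on $\mathbb{C}^n$. For a holomorphic map $\Gamma:\mathbb{C}^n\to\mathbb{C}^n$, the composition operator is $C_\Gamma f=f\circ\Gamma$. ''Bounded on $F_\psi^2$'' means that the operator maps $F_\psi^2$ into itself and is a bounded linear operator. The adjoint of an operator is taken in the Hilbert space $F_\psi^2$. *)

(* Defs.v *)
From HB Require Import structures.
From mathcomp Require Import all_boot all_order all_algebra.
From mathcomp Require Import sesquilinear spectral.
From mathcomp Require Import all_classical all_reals all_analysis.
From mathcomp Require Import complex.

Set Implicit Arguments.
Unset Strict Implicit.
Unset Printing Implicit Defensive.

Import Order.TTheory GRing.Theory Num.Theory.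
Import numFieldNormedType.Exports.

Local Open Scope classical_set_scope.
Local Open Scope ring_scope.

(* product_measure1 has no canonical sigma-finite structure for arbitrary
   sigma-finite factors *)
Lemma sigma_finite_prod d1 d2 (T1 : measurableType d1) (T2 : measurableType d2)
    (R : realType) (m1 : {sigma_finite_measure set T1 -> \bar R})
    (m2 : {sigma_finite_measure set T2 -> \bar R}) :
  sigma_finite setT (m1 \x m2)%E.
Proof.
have /sigma_finiteP[F [TF ndF Foo]] := sigma_finiteT m1.
have /sigma_finiteP[G [TG ndG Goo]] := sigma_finiteT m2.
exists (fun k => F k `*` G k).
  rewrite -setXTT TF TG predeqE => -[x y]; split.
    move=> [/= [k _ Fkx] [j _ Gjy]]; exists (maxn k j) => //; split.
    - by move: x Fkx; exact/subsetPset/ndF/leq_maxl.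
    - by move: y Gjy; exact/subsetPset/ndG/leq_maxr.
  by move=> [k _ []/= ? ?]; split; exists k.
move=> k; have [? ?] := Foo k; have [? ?] := Goo k.
split; first exact: measurableX.
by rewrite product_measure1E// lte_mul_pinfty// ge0_fin_numE.
Qed.

Section tuple_measure.
Context d (T : measurableType d) (R : realType).
Variable m : {sigma_finite_measure set T -> \bar R}.

Definition tuple_cons n (x : T * n.-tuple T) : n.+1.-tuple T :=
  [tuple of x.1 :: x.2].

Lemma measurable_tuple_cons n : measurable_fun setT (@tuple_cons n).
Proof. exact: (measurable_cons measurable_fst measurable_snd). Qed.

Section step.
Variables (n : nat) (mn : {sigma_finite_measure set (n.-tuple T) -> \bar R}).

Definition measure_cons : set (n.+1.-tuple T) -> \bar R :=
  pushforward (m \x mn)%E (@tuple_cons n).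

Let measurable_preimage A : measurable A ->
  measurable (@tuple_cons n @^-1` A).
Proof.
by move=> mA; rewrite -[X in measurable X]setTI; exact: measurable_tuple_cons.
Qed.

Let measure_cons0 : measure_cons set0 = 0%E.
Proof. by rewrite /measure_cons /pushforward preimage_set0 measure0. Qed.

Let measure_cons_ge0 A : (0 <= measure_cons A)%E.
Proof. by rewrite /measure_cons /pushforward. Qed.

Let measure_cons_sigma_additive : semi_sigma_additive measure_cons.
Proof.
move=> F mF tF mUF; rewrite /measure_cons /pushforward preimage_bigcup.
apply: measure_semi_sigma_additive.
- by move=> k; exact: measurable_preimage.
- apply/trivIsetP => /= i j _ _ ij; rewrite -preimage_setI.
  by move/trivIsetP : tF => /(_ _ _ _ _ ij) ->//; rewrite preimage_set0.
- by rewrite -preimage_bigcup; exact: measurable_preimage.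
Qed.

HB.instance Definition _ := isMeasure.Build _ _ _ measure_cons
  measure_cons0 measure_cons_ge0 measure_cons_sigma_additive.

Lemma sigma_finite_measure_cons : sigma_finite setT measure_cons.
Proof.
have [F FT Foo] := sigma_finite_prod m mn.
pose uncons (t : n.+1.-tuple T) : T * n.-tuple T :=
  (thead t, [tuple of behead t]).
have consK : cancel (@tuple_cons n) uncons.
  by move=> [x t]; congr (_, _); apply: val_inj.
have muncons : measurable_fun setT uncons.
  apply/measurable_fun_pairP; split.
    exact: (@measurable_tnth _ T n.+1 ord0).
  exact: measurable_behead.
exists (fun k => uncons @^-1` F k).
  by rewrite -preimage_bigcup -FT preimage_setT.
move=> k; have [mF Fk] := Foo k; split.
  by rewrite -[X in measurable X]setTI; exact: muncons.
rewrite /measure_cons /pushforward -comp_preimage.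
by rewrite (_ : uncons \o _ = id) ?preimage_id//; apply/funext => x /=.
Qed.

HB.instance Definition _ := Measure_isSigmaFinite.Build _ _ _ measure_cons
  sigma_finite_measure_cons.

End step.

Fixpoint tuple_measure n : {sigma_finite_measure set (n.-tuple T) -> \bar R} :=
  if n is n'.+1 return {sigma_finite_measure set (n.-tuple T) -> \bar R}
  then measure_cons (tuple_measure n')
  else dirac [tuple].

Lemma tuple_measure_box n (A : 'I_n -> set T) : (forall i, measurable (A i)) ->
  tuple_measure n [set t | forall i, A i (tnth t i)] =
  (\prod_(i < n) m (A i))%E.
Proof.
elim: n A => [|n IHn] A mA.
  rewrite big_ord0 /= diracE mem_set//=; by case.
rewrite big_ord_recl -IHn; last by move=> i; exact: mA.
rewrite -product_measure1E//.
  rewrite /= /measure_cons /pushforward; congr (product_measure1 _ _ _).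
  apply/seteqP; split => -[x t]/=.
    move=> At; split; first by have := At ord0; rewrite tnth0.
    by move=> i; have := At (lift ord0 i); rewrite tnthS.
  move=> [Ax At] i; case: (unliftP ord0 i) => [j|] ->; last by rewrite tnth0.
  by rewrite tnthS; exact: At.
rewrite (_ : mkset _ = \bigcap_(i in [set: 'I_n])
    ((fun t : n.-tuple T => tnth t i) @^-1` A (lift ord0 i))); last first.
  by apply/seteqP; split => t /= At i => [_|]; exact: At.
apply: (@fin_bigcap_measurable _ (n.-tuple T) _ [set: 'I_n]) => [|i _]; first exact: finite_finset.
by rewrite -[X in measurable X]setTI; exact: measurable_tnth.
Qed.

End tuple_measure.

(* K-differentiability at every point; entire functions on C^n for K = R[i] *)
Definition holomorphic (K : numClosedFieldType) (n : nat)
    (g : 'cV[K]_n -> K) : Prop :=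
  forall z : 'cV[K]_n, differentiable g z.

Section complex_space.
Variables (R : realType) (n : nat).
Local Notation C := (R[i]).
Local Notation Cn := ('cV[C]_n).

Definition cdot (w z : Cn) : C := \sum_j w j 0 * (z j 0)^*.

(* |w|^2, as an element of R *)
Definition sqnorm (w : Cn) : R := complex.Re (cdot w w).

Definition cnorm (w : Cn) : R := Num.sqrt (sqnorm w).

Definition opnorm (A : 'M[C]_n) : R :=
  sup [set cnorm (A *m w) | w in [set w | cnorm w <= 1]].

Definition affine (A : 'M[C]_n) (D : Cn) : Cn -> Cn := fun z => A *m z + D.

Definition comp_op (Gamma : Cn -> Cn) : (Cn -> C) -> (Cn -> C) :=
  fun f => f \o Gamma.

(* Lebesgue measure of R^(n + n), identified with C^n by to_Cn; integrals over
   C^n are pulled back along to_Cn *)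
Definition lebesgue_Cn :
    {sigma_finite_measure set ((n + n).-tuple (measurableTypeR R)) -> \bar R} :=
  tuple_measure (@lebesgue_measure R) (n + n).

Definition to_Cn (t : (n + n).-tuple (measurableTypeR R)) : Cn :=
  \col_j Complex (tnth t (lshift n j)) (tnth t (rshift n j)).

Definition cintegral (F : Cn -> C) : C :=
  Complex (\int[lebesgue_Cn]_t complex.Re (F (to_Cn t)))
          (\int[lebesgue_Cn]_t complex.Im (F (to_Cn t))).

End complex_space.

(* needed by the notation =O_+oo *)
Canonical pinfty_filter_on (K : numFieldType) :=
  FilterType (pinfty_nbhs K) (@proper_pinfty_nbhs K).

Section half_line.
Variable R : realType.
Implicit Types f : R -> R.

(* Calculus on [0, +oo[: only the values of f on [0, +oo[ matter, and the
   derivative at 0 is one-sided *)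
Definition quotient_ge0 f (y : R) : R -> R := fun x => (f x - f y) / (x - y).

Definition near_ge0 (y : R) := within `[0, +oo[ (y^').

Definition derivable_ge0 f : Prop :=
  forall y, 0 <= y -> cvg (quotient_ge0 f y @ near_ge0 y).

Definition derive_ge0 f : R -> R :=
  fun y => lim (quotient_ge0 f y @ near_ge0 y).

Definition derive_ge0n (k : nat) f : R -> R := iter k derive_ge0 f.

Definition Ck_ge0 (k : nat) f : Prop :=
  (forall j, (j < k)%N -> derivable_ge0 (derive_ge0n j f)) /\
  {within `[0, +oo[, continuous (derive_ge0n k f)}.

Definition phi f : R -> R := fun y => y * derive_ge0 f y.

Definition weight (n : nat) (psi : R -> R) : Prop :=
  [/\ forall y, 0 <= y -> 0 <= psi y,
      Ck_ge0 3 psi,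
      forall y, 0 <= y -> [/\ 0 < derive_ge0 psi y,
        0 <= derive_ge0n 2 psi y & 0 <= derive_ge0n 3 psi y] &
      exists l : R, [/\ l < 2^-1,
        derive_ge0n 2 (phi psi) =O_+oo
          (fun y => y `^ (- 2^-1) * derive_ge0 (phi psi) y `^ (1 + l)) &
        (1 < n)%N -> derive_ge0n 2 psi =O_+oo
          (fun y => y `^ (- 2^-1) * derive_ge0 psi y `^ (1 + l))]].

End half_line.

Section fock_space.
Variables (R : realType) (n : nat) (psi : R -> R).
Local Notation C := (R[i]).
Local Notation Cn := ('cV[C]_n).
Implicit Types (f g h : Cn -> C) (T S : (Cn -> C) -> (Cn -> C)).

Definition density (z : Cn) : R := expR (- psi (sqnorm z)).

Definition fock g : Prop :=
  holomorphic g /\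
  (\int[lebesgue_Cn R n]_t
     (Normc.normc (g (to_Cn t)) ^+ 2 * density (to_Cn t))%:E < +oo)%E.

Definition fock_dot g h : C :=
  cintegral (fun z => g z * (h z)^* * (density z)%:C%C).

Definition fock_norm g : R := Num.sqrt (complex.Re (fock_dot g g)).

Definition bounded_operator T : Prop :=
  [/\ forall f, fock f -> fock (T f),
      forall (a : C) f g, fock f -> fock g ->
        T (fun z => a * f z + g z) =1 (fun z => a * T f z + T g z) &
      exists M : R, forall f, fock f -> fock_norm (T f) <= M * fock_norm f].

(* S is the adjoint of T; it is unique as a map on fock, because fock consists
   of continuous functions, on which fock_dot is definite *)
Definition is_adjoint T S : Prop :=
  [/\ bounded_operator T, bounded_operator S &
      forall f g, fock f -> fock g -> fock_dot (T f) g = fock_dot f (S g)].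

End fock_space.

(* Main.v *)
Require Import Defs.
From HB Require Import structures.
From mathcomp Require Import all_boot all_order perm all_algebra.
From mathcomp Require Import sesquilinear spectral.
From mathcomp Require Import all_classical all_reals all_analysis measurable_realfun.
From mathcomp Require Import complex ring lra.

(** Sufficiency.  Let C2 = C1^* and let both translations vanish.  Everything
    rests on the unitary invariance of Lebesgue measure on C^n: as the weight
    depends on |z| only, <f o M, g> = <f, g o M^*> for every unitary M.  To reach
    a contraction A, write A = U diag(s) V with U, V unitary and 0 <= s_j <= 1,
    and replace each singular value s_j by the Blaschke factor
    (s_j + l) / (1 + s_j l).  The resulting matrix M(l) is holomorphic in l on
    the closed unit disc, is A at l = 0, is unitary for |l| = 1, and M(l)^* is
    the matrix built in the same way from A^*, at the conjugate of l.  By the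
    mean value property, f (A z) is the average of f (M(l) z) over the circle
    |l| = 1, whence by Fubini <f o A, g> is the average of
    <f o M(l), g> = <f, g o M(l)^*>; the same average, read for A^*, is
    <f, g o A^*>.  This is [fock_dot_adjoint_matrix].

    Three ingredients carry this argument.  [unitary_preserves] is deduced
    from translation invariance by measuring a set of pairs in two ways.
    [mean_value] comes from Goursat's theorem ([goursat]), since holomorphy here
    is mere differentiability at each point: h (exp (u + i v)) is holomorphic on
    a half strip and 2 pi-periodic in v, so its integral over a period does not
    depend on u, and u tends to -oo.  The decomposition of A is
    [singular_value_decomposition].

    Necessity.  Convexity gives psi y >= psi'(0) y with psi'(0) > 0, so constants
    and coordinates belong to the space ([fock_of_linear_growth]).  Sign changes
    and exchanges of coordinates are unitary, so 1, z_1, ..., z_n are orthogonal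
    and the z_j have a common positive norm.  The adjoint relation between z_j
    and 1 then says D1 = 0 and D2 = 0, and between z_i and z_j it says
    C1^* = C2. *)

Set Implicit Arguments.
Unset Strict Implicit.
Unset Printing Implicit Defensive.

Import Order.TTheory GRing.Theory Num.Theory.
Import numFieldNormedType.Exports.
Local Open Scope classical_set_scope.
Local Open Scope ring_scope.
Local Open Scope sesquilinear_scope.

(** * Integrals over segments *)
Section itv_integral.
Context {R : realType}.
Implicit Types (f g : R -> R) (a b : R).

Definition itv_int a b f := \int[@lebesgue_measure R]_(x in `[a, b]) f x.

Local Notation integrable_on a b f :=
  ((@lebesgue_measure R).-integrable `[a, b] (EFin \o f)).

Lemma itv_integrable a b f : continuous f -> integrable_on a b f.
Proof.
move=> cf; apply: continuous_compact_integrable; first exact: segment_compact.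
exact: continuous_subspaceT.
Qed.

Lemma itv_integrable_sub a b c d f : a <= c -> d <= b ->
  integrable_on a b f -> integrable_on c d f.
Proof.
move=> ac db; apply: integrableS => //=.
by apply: subset_itvScc; rewrite bnd_simp.
Qed.

Lemma itv_integrable_cst a b (c : R) : integrable_on a b (fun=> c).
Proof. by apply: itv_integrable => x; exact: cst_continuous. Qed.

Lemma itv_integrableB a b f g : integrable_on a b f -> integrable_on a b g ->
  integrable_on a b (fun x => f x - g x).
Proof.
by move=> fi gi; have /= := integrableB _ fi gi; apply; exact: measurable_itv.
Qed.

Lemma itv_int_split a c b f : integrable_on a b f -> a <= c -> c <= b ->
  itv_int a b f = itv_int a c f + itv_int c b f.
Proof.
move=> fi ac cb; rewrite /itv_int.
have := @Rintegral_itvB R f (BLeft a) (BRight b) c fi.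
rewrite !bnd_simp => /(_ ac cb)/eqP; rewrite subr_eq => /eqP ->.
rewrite Rintegral_itv_obnd_cbnd; first by rewrite addrC.
apply: (integrableS _ _ _ fi) => //=.
by apply: subset_itvr; rewrite bnd_simp.
Qed.

Lemma itv_intB a b f g : integrable_on a b f -> integrable_on a b g ->
  itv_int a b (fun x => f x - g x) = itv_int a b f - itv_int a b g.
Proof. by move=> fi gi; rewrite /itv_int RintegralB. Qed.

Lemma itv_int_cst a b c : a <= b -> itv_int a b (fun=> c) = c * (b - a).
Proof.
move=> ab; have E : (@lebesgue_measure R) `[a, b]%classic = (b - a)%:E.
  rewrite lebesgue_measure_itv/= lte_fin.
  by move: ab; rewrite le_eqVlt => /predU1P[->|->//]; rewrite ltxx subrr.
by rewrite /itv_int Rintegral_cst//= [X in fine X]E.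
Qed.

Lemma itv_int_norm_le a b f (M : R) : a <= b -> integrable_on a b f ->
  (forall x, a <= x <= b -> `|f x| <= M) -> `|itv_int a b f| <= M * (b - a).
Proof.
move=> ab fi fM; rewrite -itv_int_cst//.
apply: le_trans; first exact: le_normr_Rintegral.
apply: le_Rintegral => //; last exact: itv_integrable_cst.
exact: integrable_norm.
Qed.

End itv_integral.

Notation integrable_on a b f :=
  ((@lebesgue_measure _).-integrable `[a, b] (EFin \o f)).

(** * The theorem of Goursat for rectangles *)
Section goursat.
Context {R : realType}.
Variables (P Q : R -> R -> R) (a0 b0 : R).
Hypothesis intP : forall u c d, a0 <= u <= b0 -> integrable_on c d (P u).
Hypothesis intQ : forall v, integrable_on a0 b0 (Q ^~ v).

(** The imaginary part of the integral of P + i Q along the boundary of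
    [a, b] x [c, d]. *)
Definition rect_circulation a b c d :=
  itv_int c d (fun v => P b v - P a v) - itv_int a b (fun u => Q u d - Q u c).

Let intQ' a b v : a0 <= a -> b <= b0 -> integrable_on a b (Q ^~ v).
Proof. by move=> ? ?; apply: itv_integrable_sub (intQ v). Qed.

Let intPB a b c d : a0 <= a <= b0 -> a0 <= b <= b0 ->
  itv_int c d (fun v => P b v - P a v) = itv_int c d (P b) - itv_int c d (P a).
Proof. by move=> ha hb; apply: itv_intB; exact: intP. Qed.

Let intQB a b c d : a0 <= a -> b <= b0 ->
  itv_int a b (fun u => Q u d - Q u c) =
  itv_int a b (Q ^~ d) - itv_int a b (Q ^~ c).
Proof. by move=> ha hb; apply: itv_intB; exact: intQ'. Qed.

Lemma rect_circulation_splitu a e b c d :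
  a0 <= a -> b <= b0 -> a <= e -> e <= b ->
  rect_circulation a b c d = rect_circulation a e c d + rect_circulation e b c d.
Proof.
move=> a0a bb0 ae eb; rewrite /rect_circulation (@itv_int_split _ a e b)//; last first.
  by apply: itv_integrableB; exact: intQ'.
rewrite !intPB; [ring|lra..].
Qed.

Lemma rect_circulation_splitv a b c e d :
  a0 <= a -> a <= b -> b <= b0 -> c <= e -> e <= d ->
  rect_circulation a b c d = rect_circulation a b c e + rect_circulation a b e d.
Proof.
move=> a0a ab bb0 ce ed; rewrite /rect_circulation (@itv_int_split _ c e d)//; last first.
  by apply: itv_integrableB; apply: intP; lra.
by rewrite !intQB//; ring.
Qed.

(** Differentiability of P + i Q at u0 + i v0, with derivative al + i be, as real
    estimates. *)
Definition cauchy_riemann_at (u0 v0 : R) := exists al be : R, forall e : R, 0 < e ->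
  exists2 r : R, 0 < r & forall u v, `|u - u0| < r -> `|v - v0| < r ->
    `|P u v - P u0 v0 - (al * (u - u0) - be * (v - v0))|
       <= e * (`|u - u0| + `|v - v0|) /\
    `|Q u v - Q u0 v0 - (be * (u - u0) + al * (v - v0))|
       <= e * (`|u - u0| + `|v - v0|).

(** The affine approximation of P + i Q has no circulation, and the error made by
    it is at most e times the diameter, along a contour of comparable length. *)
Lemma small_rect_circulation u0 v0 (e : R) : cauchy_riemann_at u0 v0 -> 0 < e ->
  exists2 r : R, 0 < r & forall a b c d, a0 <= a -> b <= b0 ->
    a <= u0 <= b -> c <= v0 <= d ->
    b - a < r -> d - c < r ->
    `|rect_circulation a b c d| <= e * ((b - a) + (d - c)) ^+ 2.
Proof.
move=> [al [be H]] e0; have [r r0 {}H] := H (e / 2) (divr_gt0 e0 (ltr0n _ 2)).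
exists r => // a b c d a0a bb0 /andP[au ub] /andP[cv vd] bar dcr.
have ab : a <= b by lra.
have cd : c <= d by lra.
have iP : integrable_on c d (fun v => P b v - P a v).
  by apply: itv_integrableB; apply: intP; lra.
have iQ : integrable_on a b (fun u => Q u d - Q u c).
  by apply: itv_integrableB; exact: intQ'.
have -> : rect_circulation a b c d =
   itv_int c d (fun v => P b v - P a v - al * (b - a)) -
   itv_int a b (fun u => Q u d - Q u c - al * (d - c)).
  rewrite /rect_circulation (itv_intB iP (itv_integrable_cst _ _ _)).
  rewrite (itv_intB iQ (itv_integrable_cst _ _ _)) !itv_int_cst//; ring.
have bd x y : a <= x <= b -> c <= y <= d -> `|x - u0| < r /\ `|y - v0| < r
   /\ e / 2 * (`|x - u0| + `|y - v0|) <= e / 2 * ((b - a) + (d - c)).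
  move=> /andP[ax xb] /andP[cy yd].
  have hx : `|x - u0| <= b - a by rewrite ler_norml; apply/andP; split; lra.
  have hy : `|y - v0| <= d - c by rewrite ler_norml; apply/andP; split; lra.
  split; first exact: le_lt_trans hx bar.
  split; first exact: le_lt_trans hy dcr.
  by rewrite ler_pM2l ?divr_gt0// lerD.
have I1 : `|itv_int c d (fun v => P b v - P a v - al * (b - a))|
     <= e * ((b - a) + (d - c)) * (d - c).
  apply: itv_int_norm_le => //.
    by apply: itv_integrableB => //; exact: itv_integrable_cst.
  move=> v cvd; have [|h1 [h2 h3]] := bd b v _ cvd; first by rewrite ab lexx.
  have [|k1 [k2 k3]] := bd a v _ cvd; first by rewrite ab lexx.
  have [A _] := H b v h1 h2; have [B _] := H a v k1 k2.
  have := le_trans A h3; have := le_trans B k3; clear.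
  rewrite !ler_norml => /andP[? ?] /andP[? ?]; apply/andP; split; lra.
have I2 : `|itv_int a b (fun u => Q u d - Q u c - al * (d - c))|
     <= e * ((b - a) + (d - c)) * (b - a).
  apply: itv_int_norm_le => //.
    by apply: itv_integrableB => //; exact: itv_integrable_cst.
  move=> u aub; have [|h1 [h2 h3]] := bd u d aub; first by rewrite cd lexx.
  have [|k1 [k2 k3]] := bd u c aub; first by rewrite cd lexx.
  have [_ A] := H u d h1 h2; have [_ B] := H u c k1 k2.
  have := le_trans A h3; have := le_trans B k3; clear.
  rewrite !ler_norml => /andP[? ?] /andP[? ?]; apply/andP; split; lra.
apply: le_trans (ler_normB _ _) _; apply: le_trans (lerD I1 I2) _.
rewrite le_eqVlt; apply/orP; left; apply/eqP; ring.
Qed.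

Let mid (x y : R) := (x + y) / 2.

(* bisection: the first quarter whose circulation exceeds m in absolute value *)
Let next (m : R) (x : R * R * (R * R)) : R * R * (R * R) :=
  let: ((a, b), (c, d)) := x in
  if m < `|rect_circulation a (mid a b) c (mid c d)| then ((a, mid a b), (c, mid c d)) else
  if m < `|rect_circulation a (mid a b) (mid c d) d| then ((a, mid a b), (mid c d, d)) else
  if m < `|rect_circulation (mid a b) b c (mid c d)| then ((mid a b, b), (c, mid c d)) else
  ((mid a b, b), (mid c d, d)).

(** If the circulation were nonzero, some quarter of the rectangle would have at
    least a quarter of it; iterating gives rectangles that shrink to a point and
    have circulation of the order of their squared diameter, which
    differentiability at that point forbids. *)
Lemma goursat c d : a0 < b0 -> c < d ->
  (forall u v, a0 <= u <= b0 -> c <= v <= d -> cauchy_riemann_at u v) ->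
  rect_circulation a0 b0 c d = 0.
Proof.
move=> ab cd CR; apply/eqP; apply/negPn/negP => J0.
(* halving keeps every inequality of the bisection strict *)
set m := `|rect_circulation a0 b0 c d| / 2.
have m0 : 0 < m by rewrite divr_gt0// normr_gt0.
pose fix s k := if k is k'.+1 then next (m / 4 ^+ k) (s k') else ((a0, b0), (c, d)).
pose A k := (s k).1.1; pose B k := (s k).1.2.
pose C k := (s k).2.1; pose D k := (s k).2.2.
have step (k : nat) : let M := mid (A k) (B k) in let N := mid (C k) (D k) in
   m / 4 ^+ k < `|rect_circulation (A k) (B k) (C k) (D k)| ->
   a0 <= A k -> B k <= b0 -> A k <= B k -> C k <= D k ->
   [/\ A k.+1 = A k /\ B k.+1 = M \/ A k.+1 = M /\ B k.+1 = B k,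
       C k.+1 = C k /\ D k.+1 = N \/ C k.+1 = N /\ D k.+1 = D k &
       m / 4 ^+ k.+1 <
         `|rect_circulation (A k.+1) (B k.+1) (C k.+1) (D k.+1)|].
  rewrite /A /B /C /D /=; case: (s k) => -[x y] [z w] /= H xy zw.
  case: ifP => h1; first by split => //=; left.
  case: ifP => h2; first by split => //=; [left|right].
  case: ifP => h3; first by split => //=; [right|left].
  split => /=; [by right|by right|].
  move/negbT: h1; move/negbT: h2; move/negbT: h3; rewrite -!leNgt => h3 h2 h1.
  have xm : x <= mid x y by rewrite /mid; lra.
  have my : mid x y <= y by rewrite /mid; lra.
  have zn : z <= mid z w by rewrite /mid; lra.
  have nw : mid z w <= w by rewrite /mid; lra.
  have a0m : a0 <= mid x y by lra.
  have mb0 : mid x y <= b0 by lra.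
  move: H; rewrite (rect_circulation_splitu _ _ _ _ xm my)//.
  rewrite (rect_circulation_splitv _ _ _ zn nw)// (rect_circulation_splitv _ _ _ zn nw)// => H.
  have E : m / 4 ^+ k = 4 * (m / 4 ^+ k.+1).
    by rewrite exprS; field; rewrite expf_neq0.
  rewrite E in H.
  have := ler_normD (rect_circulation x (mid x y) z (mid z w) + rect_circulation x (mid x y) (mid z w) w) (rect_circulation (mid x y) y z (mid z w) + rect_circulation (mid x y) y (mid z w) w).
  have := ler_normD (rect_circulation x (mid x y) z (mid z w)) (rect_circulation x (mid x y) (mid z w) w).
  have := ler_normD (rect_circulation (mid x y) y z (mid z w)) (rect_circulation (mid x y) y (mid z w) w).
  lra.
have inv k : [/\ B k - A k = (b0 - a0) / 2 ^+ k, D k - C k = (d - c) / 2 ^+ k,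
   a0 <= A k, B k <= b0 & m / 4 ^+ k < `|rect_circulation (A k) (B k) (C k) (D k)|].
  elim: k => [|k [hB hD hA0 hB0 hJ]].
    rewrite !expr0 !divr1; split=> //; rewrite /A/B/C/D/= /m.
    have : 0 < `|rect_circulation a0 b0 c d| by rewrite normr_gt0.
    lra.
  have p2 : (0 : R) < 2 ^+ k by rewrite exprn_gt0.
  have [||e1 e2 e3] := step k hJ hA0 hB0.
  - by rewrite -subr_ge0 hB divr_ge0 ?ltW// subr_gt0.
  - by rewrite -subr_ge0 hD divr_ge0 ?ltW// subr_gt0.
  have -> : (b0 - a0) / 2 ^+ k.+1 = (b0 - a0) / 2 ^+ k / 2.
    by rewrite exprS; field; exact: lt0r_neq0.
  have -> : (d - c) / 2 ^+ k.+1 = (d - c) / 2 ^+ k / 2.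
    by rewrite exprS; field; exact: lt0r_neq0.
  have ABk : A k < B k by rewrite -subr_gt0 hB divr_gt0// subr_gt0.
  rewrite -hB -hD; split=> //.
  + by move: e1; clear => -[] [-> ->]; rewrite /mid; lra.
  + by move: e2; clear => -[] [-> ->]; rewrite /mid; lra.
  + by move: e1 => [] [-> _]; rewrite ?/mid; lra.
  + by move: e1 => [] [_ ->]; rewrite ?/mid; lra.
have AB k : A k < B k.
  by rewrite -subr_gt0; have [-> _ _ _ _] := inv k; rewrite divr_gt0 ?exprn_gt0// subr_gt0.
have CD k : C k < D k.
  by rewrite -subr_gt0; have [_ -> _ _ _] := inv k; rewrite divr_gt0 ?exprn_gt0// subr_gt0.
have mono k : [/\ A k <= A k.+1, B k.+1 <= B k, C k <= C k.+1 & D k.+1 <= D k].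
  have [_ _ hA hB J] := inv k; have [e1 e2 _] := step k J hA hB (ltW (AB k)) (ltW (CD k)).
  have := AB k; have := CD k.
  by case: e1 => [] [-> ->]; case: e2 => [] [-> ->]; rewrite /mid; clear => ? ?; split; lra.
(* nested segments have a common point *)
have point (X Y : nat -> R) : (forall k, X k < Y k) -> (forall k, X k <= X k.+1) ->
    (forall k, Y k.+1 <= Y k) -> exists p, forall k, X k <= p <= Y k.
  move=> XY incX decY.
  have ndX : {homo X : i j / (i <= j)%N >-> i <= j} by apply/nondecreasing_seqP.
  have niY : {homo Y : i j / (i <= j)%N >-> j <= i} by apply/nonincreasing_seqP.
  have XYij i j : X i <= Y j.
    apply: le_trans (ndX _ _ (leq_maxl i j)) _.
    apply: le_trans (ltW (XY _)) _; exact: niY (leq_maxr i j).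
  have hs : has_sup (range X).
    by split; [exists (X 0%N), 0%N|exists (Y 0%N) => _ [i _ <-]].
  exists (sup (range X)) => k; apply/andP; split.
    by apply: sup_ubound; [exact: hs.2|exists k].
  by apply: sup_le_ub; [exact: hs.1|move=> _ [i _ <-]].
have [u0 hu] := point A B AB (fun k => let: And4 h _ _ _ := mono k in h)
  (fun k => let: And4 _ h _ _ := mono k in h).
have [v0 hv] := point C D CD (fun k => let: And4 _ _ h _ := mono k in h)
  (fun k => let: And4 _ _ _ h := mono k in h).
set S := ((b0 - a0) + (d - c)).
have S0 : 0 < S by rewrite /S; lra.
have e0 : 0 < m / S ^+ 2 by rewrite divr_gt0// exprn_gt0.
have [r r0 small] := small_rect_circulation (CR u0 v0 (hu 0%N) (hv 0%N)) e0.
have [k kr] : exists k, S / 2 ^+ k < r.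
  exists (Num.bound (S / r)).
  rewrite ltr_pdivrMr ?exprn_gt0// mulrC -ltr_pdivrMr//.
  apply: le_lt_trans (ler_norm _) _.
  have := archi_boundP (normr_ge0 (S / r)); move=> /lt_le_trans; apply.
  rewrite gtr0_norm ?divr_gt0// -natrX ler_nat.
  exact/ltnW/ltn_expl.
have [hB hD hA0 hB0 hJ] := inv k.
have p2 : (0 : R) < 2 ^+ k by rewrite exprn_gt0.
have bk0 : 0 < (b0 - a0) / 2 ^+ k by rewrite divr_gt0// subr_gt0.
have dk0 : 0 < (d - c) / 2 ^+ k by rewrite divr_gt0// subr_gt0.
have ES : S / 2 ^+ k = (b0 - a0) / 2 ^+ k + (d - c) / 2 ^+ k by rewrite /S mulrDl.
have := small _ _ _ _ hA0 hB0 (hu k) (hv k).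
have bkr : (b0 - a0) / 2 ^+ k < r by lra.
have dkr : (d - c) / 2 ^+ k < r by lra.
rewrite hB hD => /(_ bkr dkr) h.
move: hJ; rewrite ltNge => /negP; apply; apply: le_trans h _.
have -> : (4 : R) ^+ k = (2 ^+ k) ^+ 2.
  by rewrite exprAC (_ : 4 = 2 ^+ 2)// expr2; lra.
have alg (x p : R) : 0 < x -> 0 < p -> m / x ^+ 2 * (x / p) ^+ 2 = m / p ^+ 2.
  by move=> x0 p0; field; apply/andP; split; exact: lt0r_neq0.
by rewrite -ES alg.
Qed.

End goursat.
(** * Complex numbers as pairs *)
Section complex_basics.
Context {R : realType}.
Implicit Types (x y z : R[i]).
Local Notation normc := (@Normc.normc R).

Lemma cReD x y : complex.Re (x + y) = complex.Re x + complex.Re y.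
Proof. by case: x y => [? ?] []. Qed.
Lemma cImD x y : complex.Im (x + y) = complex.Im x + complex.Im y.
Proof. by case: x y => [? ?] []. Qed.
Lemma cReB x y : complex.Re (x - y) = complex.Re x - complex.Re y.
Proof. by case: x y => [? ?] []. Qed.
Lemma cImB x y : complex.Im (x - y) = complex.Im x - complex.Im y.
Proof. by case: x y => [? ?] []. Qed.
Lemma cReM x y : complex.Re (x * y) =
  complex.Re x * complex.Re y - complex.Im x * complex.Im y.
Proof. by case: x y => [? ?] []. Qed.
Lemma cImM x y : complex.Im (x * y) =
  complex.Re x * complex.Im y + complex.Im x * complex.Re y.
Proof. by case: x y => [? ?] []. Qed.
Lemma cReJ z : complex.Re z^* = complex.Re z. Proof. by case: z. Qed.
Lemma cImJ z : complex.Im z^* = - complex.Im z. Proof. by case: z. Qed.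

Lemma complex_eq x y : complex.Re x = complex.Re y ->
  complex.Im x = complex.Im y -> x = y.
Proof. by case: x y => [? ?] [? ?] /= -> ->. Qed.

Lemma normcE2 z : normc z ^+ 2 = complex.Re z ^+ 2 + complex.Im z ^+ 2.
Proof. by case: z => a b /=; rewrite sqr_sqrtr// addr_ge0// sqr_ge0. Qed.

Lemma normc_ge0 z : 0 <= normc z.
Proof. by case: z => a b; exact: sqrtr_ge0. Qed.

Lemma normc_Re z : `|complex.Re z| <= normc z.
Proof.
rewrite -(ler_pXn2r (ltn0Sn 1)) ?nnegrE ?normc_ge0// normcE2 real_normK ?num_real//.
by rewrite lerDl sqr_ge0.
Qed.

Lemma normc_Im z : `|complex.Im z| <= normc z.
Proof.
rewrite -(ler_pXn2r (ltn0Sn 1)) ?nnegrE ?normc_ge0// normcE2 real_normK ?num_real//.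
by rewrite lerDr sqr_ge0.
Qed.

Lemma normc_le_ReIm z : normc z <= `|complex.Re z| + `|complex.Im z|.
Proof.
rewrite -(ler_pXn2r (ltn0Sn 1)) ?nnegrE ?normc_ge0 ?addr_ge0// normcE2 sqrrD.
by rewrite !real_normK ?num_real// addrAC lerDl mulrn_wge0// mulr_ge0.
Qed.

Lemma normc_conj z : normc z^* = normc z.
Proof. by case: z => a b /=; rewrite sqrrN. Qed.

Lemma normc_real (r : R) : normc r%:C%C = `|r|.
Proof. by rewrite /= expr0n addr0 sqrtr_sqr. Qed.

Lemma normC_normc z : `|z| = (normc z)%:C%C. Proof. by []. Qed.

End complex_basics.

(** * The mean value property on the unit circle *)
Section mean_value.
Context {R : realType}.
Local Notation C := R[i].
Local Notation normc := (@Normc.normc R).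

(** Complex differentiability by estimates in the real-valued norm, the form in
    which real and imaginary parts are read off. *)
Definition cderiv_at (h : C -> C) (z c : C) := forall e : R, 0 < e ->
  exists2 r : R, 0 < r & forall k, normc k < r ->
    normc (h (z + k) - h z - c * k) <= e * normc k.

(** exp (u + i v) *)
Definition cexp (u v : R) : C := Complex (expR u * cos v) (expR u * sin v).

Lemma cexpD u v a b : cexp (u + a) (v + b) = cexp u v * cexp a b.
Proof. by apply: complex_eq; rewrite /= expRD (cosD, sinD); ring. Qed.

Lemma normc_cexp u v : normc (cexp u v) = expR u.
Proof.
rewrite /= !exprMn -mulrDr cos2Dsin2 mulr1 sqrtr_sqr ger0_norm//; exact: expR_ge0.
Qed.

Lemma is_derive_estimate (f : R -> R) (x d e : R) : is_derive x 1 f d -> 0 < e ->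
  exists2 r : R, 0 < r & forall k, `|k| < r ->
    `|f (x + k) - f x - d * k| <= e * `|k|.
Proof.
move=> [df fd] e0.
have : (fun k : R => k^-1 *: (f (k *: 1 + x) - f x)) @ 0^' --> d.
  by rewrite -fd; exact: df.
move/cvgrPdist_le => /(_ _ e0)[r /= r0 H]; exists r => // k kr.
have [->|k0] := eqVneq k 0; first by rewrite addr0 subrr mulr0 subrr normr0 mulr0.
have := H k; rewrite /= sub0r normrN => /(_ kr k0).
rewrite [k%:A]mulr1 (addrC k) => h.
have -> : f (x + k) - f x - d * k = - ((d - k^-1 * (f (x + k) - f x)) * k).
  by field.
by rewrite normrN normrM ler_wpM2r.
Qed.

Lemma cexp_deriv0 (e : R) : 0 < e -> exists2 r : R, 0 < r &
  forall a b, `|a| < r -> `|b| < r ->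
  normc (cexp a b - 1 - Complex a b) <= e * (`|a| + `|b|).
Proof.
move=> e0.
pose e1 := e / 5; have e10 : 0 < e1 by rewrite divr_gt0.
have [r1 r10 H1] := is_derive_estimate (is_derive_expR (0 : R)) e10.
have [r2 r20 H2] := is_derive_estimate (is_derive_cos (0 : R)) e10.
have [r3 r30 H3] := is_derive_estimate (is_derive_sin (0 : R)) e10.
have [r4 r40 H4] := is_derive_estimate (is_derive_expR (0 : R)) ltr01.
exists (Num.min (Num.min (Num.min r1 r2) (Num.min r3 r4)) (Num.min (1/2) (e1 / 2))).
  by rewrite !lt_min r10 r20 r30 r40 !divr_gt0.
move=> a b; rewrite !lt_min.
move=> /andP[/andP[/andP[ar1 ar2] /andP[ar3 ar4]] /andP[ah ae]].
move=> /andP[/andP[/andP[br1 br2] /andP[br3 br4]] /andP[bh be]].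
have := H1 a ar1; have := H2 b br2; have := H3 b br3; have := H4 a ar4.
rewrite !add0r expR0 cos0 sin0 subr0 oppr0 mul0r subr0 !mul1r => K4 K3 K2 K1.
have A : expR a <= 2.
  move: K4; rewrite ler_norml => /andP[_ K4]; have := ler_norm a; lra.
have B : `|expR a - 1| <= e1.
  have -> : expR a - 1 = (expR a - 1 - a) + a by ring.
  apply: le_trans (ler_normD _ _) _; lra.
apply: le_trans (normc_le_ReIm _) _; rewrite /= ?subr0 ?sub0r.
have -> : expR a * cos b - 1 - a = (expR a - 1 - a) + expR a * (cos b - 1) by ring.
have -> : expR a * sin b - b = expR a * (sin b - b) + (expR a - 1) * b by ring.
have E0 : `|expR a| = expR a by rewrite ger0_norm// expR_ge0.
have X1 : `|expR a * (cos b - 1)| <= 2 * (e1 * `|b|).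
  by rewrite normrM E0; apply: ler_pM => //; exact: expR_ge0.
have X2 : `|expR a * (sin b - b)| <= 2 * (e1 * `|b|).
  by rewrite normrM E0; apply: ler_pM => //; exact: expR_ge0.
have X3 : `|(expR a - 1) * b| <= e1 * `|b| by rewrite normrM ler_wpM2r.
have Y1 := ler_normD (expR a - 1 - a) (expR a * (cos b - 1)).
have Y2 := ler_normD (expR a * (sin b - b)) ((expR a - 1) * b).
have a0 := normr_ge0 a; have b0 := normr_ge0 b.
have ea0 : 0 <= e1 * `|a| by rewrite mulr_ge0// ltW.
have -> : e = 5 * e1 by rewrite /e1; field.
by clear -K1 X1 X2 X3 Y1 Y2 a0 b0 ea0; lra.
Qed.

Section disc.
Variable h : C -> C.
Hypothesis dh : forall z, normc z <= 1 -> exists c, cderiv_at h z c.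

Let P u v := complex.Re (h (cexp u v)).
Let Q u v := complex.Im (h (cexp u v)).

(** The chain rule for h (exp (u + i v)): the derivative is c exp (u + i v), and
    u <= 0 keeps the argument in the closed disc. *)
Lemma cauchy_riemann_cexp (u v : R) : u <= 0 -> cauchy_riemann_at P Q u v.
Proof.
move=> u0; set z := cexp u v.
have [c hc] : exists c, cderiv_at h z c.
  by apply: dh; rewrite normc_cexp -expR0 ler_expR.
exists (complex.Re (c * z)), (complex.Im (c * z)) => e e0.
have N1 : 0 < 1 + normc z by rewrite ltr_pwDl// normc_ge0.
have N2 : 0 < 1 + normc (c * z) by rewrite ltr_pwDl// normc_ge0.
pose eh := e / (4 * (1 + normc z)).
pose e1 := Num.min 1 (e / (2 * (1 + normc (c * z)))).
have eh0 : 0 < eh by rewrite divr_gt0// mulr_gt0.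
have e10 : 0 < e1 by rewrite lt_min ltr01 divr_gt0// mulr_gt0.
have [rh rh0 Hh] := hc _ eh0.
have [r1 r10 H1] := cexp_deriv0 e10.
exists (Num.min r1 (rh / (4 * (1 + normc z)))).
  by rewrite lt_min r10 divr_gt0// mulr_gt0.
move=> u' v'; rewrite !lt_min => /andP[ua ub] /andP[va vb].
set a := u' - u in ua ub *; set b := v' - v in va vb *.
have h1 := H1 a b ua va.
set s := `|a| + `|b| in h1 *.
have s0 : 0 <= s by rewrite addr_ge0.
have e11 : e1 <= 1 by rewrite ge_min lexx.
have wle : normc (Complex a b) <= s by exact: (normc_le_ReIm (Complex a b)).
have k1 : normc (cexp a b - 1) <= 2 * s.
  have -> : cexp a b - 1 = (cexp a b - 1 - Complex a b) + Complex a b by ring.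
  apply: le_trans (le_normcD _ _) _.
  have : e1 * s <= 1 * s by rewrite ler_wpM2r.
  lra.
pose k := z * (cexp a b - 1).
have kle : normc k <= normc z * (2 * s).
  by rewrite Normc.normcM ler_wpM2l// normc_ge0.
have krh : normc k < rh.
  apply: le_lt_trans kle _.
  have : s < rh / (2 * (1 + normc z)).
    rewrite /s; apply: lt_le_trans (ltrD ub vb) _.
    by rewrite le_eqVlt; apply/orP; left; apply/eqP; field; exact: lt0r_neq0.
  rewrite ltr_pdivlMr ?mulr_gt0// => hs.
  by apply: le_lt_trans hs; lra.
have E : cexp u' v' = z + k.
  have -> : u' = u + a by rewrite /a; ring.
  have -> : v' = v + b by rewrite /b; ring.
  by rewrite cexpD -/z /k; ring.
have main : normc (h (cexp u' v') - h z - c * z * Complex a b) <= e * s.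
  rewrite E.
  have -> : h (z + k) - h z - c * z * Complex a b =
     (h (z + k) - h z - c * k) + c * z * (cexp a b - 1 - Complex a b).
    by rewrite /k; ring.
  apply: le_trans (le_normcD _ _) _; rewrite [X in _ + X]Normc.normcM.
  have g1 : eh * normc k <= e / 2 * s.
    apply: (@le_trans _ _ (eh * (normc z * (2 * s)))).
      by rewrite ler_wpM2l// ltW.
    apply: (@le_trans _ _ (eh * ((1 + normc z) * (2 * s)))).
      apply: ler_wpM2l; first exact: ltW.
      by apply: ler_wpM2r; [rewrite mulr_ge0|rewrite lerDr].
    rewrite /eh le_eqVlt; apply/orP; left; apply/eqP; field; exact: lt0r_neq0.
  have g2 : normc (c * z) * normc (cexp a b - 1 - Complex a b) <= e / 2 * s.
    apply: (@le_trans _ _ ((1 + normc (c * z)) * (e1 * s))).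
      by apply: ler_pM => //; rewrite ?normc_ge0// lerDr.
    apply: (@le_trans _ _ ((1 + normc (c * z)) * (e / (2 * (1 + normc (c * z))) * s))).
      apply: ler_wpM2l; first exact: ltW.
      by apply: ler_wpM2r => //; rewrite ge_min lexx orbT.
    rewrite le_eqVlt; apply/orP; left; apply/eqP; field; exact: lt0r_neq0.
  have g3 := Hh _ krh.
  lra.
split.
  apply: le_trans main; apply: le_trans (normc_Re _).
  by rewrite !cReB (cReM (c * z)).
apply: le_trans main; apply: le_trans (normc_Im _).
by rewrite !cImB (cImM (c * z)) /= [X in _ - X]addrC.
Qed.

End disc.

Lemma cauchy_riemann_continuous (P Q : R -> R -> R) u v :
  cauchy_riemann_at P Q u v ->
  {for v, continuous (P u)} /\ {for u, continuous (Q ^~ v)}.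
Proof.
move=> [al [be H]].
have [r r0 {}H] := H 1 ltr01.
have bound (B d e : R) : 0 < e -> 0 <= B -> d < e / (1 + B) -> 0 <= d -> (1 + B) * d <= e.
  move=> e0 B0; have B1 : 0 < 1 + B by lra.
  by rewrite ltr_pdivlMr// mulrC => /ltW.
split; apply/cvgrPdist_le => /= e e0.
- exists (Num.min r (e / (1 + `|be|))) => /=.
    by rewrite lt_min r0 divr_gt0// ltr_pwDl.
  move=> t; rewrite /= lt_min distrC => /andP[tr te].
  have [] := H u t; rewrite ?subrr ?normr0// mulr0 add0r mul1r add0r => h _.
  apply: le_trans (bound `|be| _ _ e0 (normr_ge0 _) te (normr_ge0 _)).
  rewrite [leLHS]distrC.
  have -> : P u t - P u v = (P u t - P u v - - (be * (t - v))) - be * (t - v) by ring.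
  apply: le_trans (ler_normB _ _) _.
  by rewrite normrM mulrDl mul1r lerD2r.
- exists (Num.min r (e / (1 + `|be|))) => /=.
    by rewrite lt_min r0 divr_gt0// ltr_pwDl.
  move=> t; rewrite /= lt_min distrC => /andP[tr te].
  have [] := H t v; rewrite ?subrr ?normr0// mulr0 ?addr0 mul1r => _; rewrite mulr0 !addr0 => h.
  apply: le_trans (bound `|be| _ _ e0 (normr_ge0 _) te (normr_ge0 _)).
  rewrite [leLHS]distrC.
  have -> : Q t v - Q u v = (Q t v - Q u v - be * (t - u)) + be * (t - u) by ring.
  apply: le_trans (ler_normD _ _) _.
  by rewrite normrM mulrDl mul1r lerD2r.
Qed.

Lemma cderiv_at_continuous (h : C -> C) z c (e : R) : cderiv_at h z c -> 0 < e ->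
  exists2 r : R, 0 < r & forall k, normc k < r -> normc (h (z + k) - h z) <= e.
Proof.
move=> hc e0; have [r r0 H] := hc 1 ltr01.
have c0 : 0 < 1 + normc c by rewrite ltr_pwDl// normc_ge0.
exists (Num.min r (e / (1 + normc c))); first by rewrite lt_min r0 divr_gt0.
move=> k; rewrite lt_min => /andP[kr ke].
have -> : h (z + k) - h z = (h (z + k) - h z - c * k) + c * k by ring.
apply: le_trans (le_normcD _ _) _; rewrite Normc.normcM.
have := H k kr; move: ke; rewrite ltr_pdivlMr// mulrDr.
by rewrite mul1r mulr1 [normc k * _]mulrC; lra.
Qed.

(** In logarithmic polar coordinates the vertical sides of a rectangle of height
    2 pi carry the averages over two circles, and the horizontal sides cancel by
    periodicity; so the averages over all circles are equal, and they tend to the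
    value at the centre as the radius expR a tends to 0. *)
Theorem mean_value (h : C -> C) :
  (forall z, normc z <= 1 -> exists c, cderiv_at h z c) ->
  itv_int 0 (2 * pi) (fun t => complex.Re (h (cexp 0 t))) =
    2 * pi * complex.Re (h 0).
Proof.
move=> dh.
pose P u v := complex.Re (h (cexp u v)).
pose Q u v := complex.Im (h (cexp u v)).
have CR (u v : R) : u <= 0 -> cauchy_riemann_at P Q u v by exact: cauchy_riemann_cexp.
have pi2 : 0 < 2 * pi :> R by rewrite mulr_gt0// pi_gt0.
have iP (u c d : R) : u <= 0 -> integrable_on c d (P u).
  move=> u0; apply: itv_integrable => v.
  by have [] := cauchy_riemann_continuous (CR u v u0).
have const (a : R) : a < 0 -> itv_int 0 (2 * pi) (P 0) = itv_int 0 (2 * pi) (P a).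
  move=> a0.
  have : rect_circulation P Q a 0 0 (2 * pi) = 0.
    apply: goursat => //.
    by move=> u c d /andP[_]; exact: iP.
    move=> v; apply: continuous_compact_integrable; first exact: segment_compact.
    apply: continuous_in_subspaceT => u; rewrite inE/= in_itv/= => /andP[_ u0].
    by have [] := cauchy_riemann_continuous (CR u v u0).
    by move=> u v /andP[_ u0] _; exact: CR.
  rewrite /rect_circulation itv_intB; [|exact: iP|by apply: iP; exact: ltW].
  have -> : (fun u => Q u (2 * pi) - Q u 0) = (fun=> 0).
    apply/funext => u; rewrite /Q /cexp.
    by rewrite (_ : 2 * pi = pi *+ 2) ?mulr_natl// cos2pi sin2pi cos0 sin0 subrr.
  rewrite (itv_int_cst 0 (ltW a0)) mul0r subr0 => /eqP; rewrite subr_eq0 => /eqP.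
  exact.
apply/eqP; rewrite -subr_eq0 -normr_le0; apply/ler_addgt0Pl => e e0; rewrite addr0.
have [c hc] : exists c, cderiv_at h 0 c by apply: dh; rewrite Normc.normc0 ler01.
have e'0 : 0 < e / (2 * pi) by rewrite divr_gt0.
have [r r0 H] := cderiv_at_continuous hc e'0.
have [a a0 ar] : exists2 a : R, a < 0 & expR a < r.
  have m0 : 0 < Num.min r 1 by rewrite lt_min r0 ltr01.
  have mr : Num.min r 1 <= r by rewrite ge_min lexx.
  have m1 : Num.min r 1 <= 1 by rewrite ge_min lexx orbT.
  exists (ln (Num.min r 1 / 2)); first by rewrite ln_lt0//; apply/andP; split; lra.
  by rewrite lnK ?posrE; lra.
rewrite -/(P 0) -[X in itv_int _ _ X]/(P 0) (const a a0).
rewrite [2 * pi * _]mulrC.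
have -> : complex.Re (h 0) * (2 * pi) =
    itv_int 0 (2 * pi) (fun=> complex.Re (h 0)).
  by rewrite itv_int_cst ?subr0// ltW.
rewrite -itv_intB; [|by apply: iP; exact: ltW|exact: itv_integrable_cst].
have -> : e = e / (2 * pi) * (2 * pi - 0) by rewrite subr0 divfK// gt_eqF.
apply: itv_int_norm_le; first exact: ltW.
  by apply: itv_integrableB; [apply: iP; exact: ltW|exact: itv_integrable_cst].
move=> v _; rewrite /P -cReB; apply: le_trans (normc_Re _) _.
have := H (cexp a v); rewrite normc_cexp add0r; exact.
Qed.

End mean_value.
(** * Differentiability as estimates *)
Section numField_estimates.
Context {K : numFieldType}.

Lemma continuous_cV_estimate n (f : 'cV[K]_n -> K) (z : 'cV[K]_n) (e : K) :
  {for z, continuous f} -> 0 < e ->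
  exists2 r : K, 0 < r & forall w : 'cV[K]_n, (forall i, `|w i 0 - z i 0| < r) ->
    `|f w - f z| <= e.
Proof.
move=> /cvgrPdist_le cf e0; have /nbhs_ballP[r /= r0 H] := cf e e0.
exists r => // w zw; rewrite distrC; apply: H; split => // i j.
by rewrite (ord1 j) -ball_normE /= distrC.
Qed.

Lemma derivable_estimate (h : K -> K) (z e : K) : derivable h z 1 -> 0 < e ->
  exists2 r : K, 0 < r & forall k, `|k| < r ->
    `|h (z + k) - h z - 'D_1 h z * k| <= e * `|k|.
Proof.
move=> dh e0.
have : (fun k : K => k^-1 *: (h (k *: 1 + z) - h z)) @ 0^' --> 'D_1 h z by exact: dh.
move/cvgrPdist_le => /(_ _ e0)[r /= r0 H]; exists r => // k kr.
have [->|k0] := eqVneq k 0; first by rewrite addr0 subrr mulr0 subrr normr0 mulr0.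
have := H k; rewrite /= sub0r normrN => /(_ kr k0).
rewrite [k%:A]mulr1 (addrC k) => hk.
have -> : h (z + k) - h z - 'D_1 h z * k =
    - (('D_1 h z - k^-1 * (h (z + k) - h z)) * k) by field.
by rewrite normrN normrM ler_wpM2r.
Qed.

Lemma derivable_along_curve n (g : 'cV[K]_n -> K) (b : 'I_n -> K -> K)
    (w : 'I_n -> 'cV[K]_n) (z : K) :
  (forall v, differentiable g v) -> (forall j, derivable (b j) z 1) ->
  derivable (fun x => g (\sum_j b j x *: w j)) z 1.
Proof.
move=> dg db; apply/derivable1_diffP.
have -> : (fun x => g (\sum_j b j x *: w j)) =
    g \o (\sum_j (fun x => b j x *: w j)).
  by apply/funext => x /=; rewrite fct_sumE.
apply: differentiable_comp => //; apply: differentiable_sum => j.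
by apply: differentiableZl; apply/derivable1_diffP.
Qed.

Lemma derivable_blaschke (s z : K) : 1 + s * z != 0 ->
  derivable (fun x => (s + x) / (1 + s * x)) z 1.
Proof.
move=> sz; apply: derivableM.
  by apply: derivableD; [exact: derivable_cst|exact: derivable_id].
exact: derivableV.
Qed.

End numField_estimates.
(** * Measurability of complex functions *)
Section complex_measurable.
Context {R : realType}.
Local Notation C := R[i].
Local Notation normc := (@Normc.normc R).

Definition cmeasurable d (T : measurableType d) (f : T -> C) :=
  measurable_fun setT (@complex.Re R \o f) /\ measurable_fun setT (@complex.Im R \o f).

Section closure.
Context d (T : measurableType d).
Implicit Types f g : T -> C.

Lemma cmeasurable_cst (c : C) : cmeasurable (fun _ : T => c).
Proof. by split; exact: measurable_cst. Qed.

Lemma cmeasurableD f g : cmeasurable f -> cmeasurable g ->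
  cmeasurable (fun t => f t + g t).
Proof.
move=> [f1 f2] [g1 g2]; split.
  by apply: eq_measurable_fun (measurable_funD f1 g1) => t _ /=; rewrite cReD.
by apply: eq_measurable_fun (measurable_funD f2 g2) => t _ /=; rewrite cImD.
Qed.

Lemma cmeasurableM f g : cmeasurable f -> cmeasurable g ->
  cmeasurable (fun t => f t * g t).
Proof.
move=> [f1 f2] [g1 g2]; split.
  apply: eq_measurable_fun (measurable_funB (measurable_funM f1 g1)
    (measurable_funM f2 g2)) => t _ /=; by rewrite cReM.
apply: eq_measurable_fun (measurable_funD (measurable_funM f1 g2)
    (measurable_funM f2 g1)) => t _ /=; by rewrite cImM.
Qed.

Lemma cmeasurableJ f : cmeasurable f -> cmeasurable (fun t => (f t)^*).
Proof.
move=> [f1 f2]; split.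
  by apply: eq_measurable_fun f1 => t _ /=; rewrite cReJ.
by apply: eq_measurable_fun (measurable_funN f2) => t _ /=; rewrite cImJ.
Qed.

Lemma cmeasurable_sum (I : Type) (s : seq I) (f : I -> T -> C) :
  (forall i, cmeasurable (f i)) -> cmeasurable (fun t => \sum_(i <- s) f i t).
Proof.
move=> mf; elim: s => [|i s IH].
  rewrite (_ : (fun t => _) = fun=> 0); first exact: cmeasurable_cst.
  by apply/funext => t; rewrite big_nil.
rewrite (_ : (fun t => _) = fun t => f i t + \sum_(j <- s) f j t).
  exact: cmeasurableD.
by apply/funext => t; rewrite big_cons.
Qed.

Lemma cmeasurable_normc f : cmeasurable f -> measurable_fun setT (fun t => normc (f t)).
Proof.
move=> [f1 f2].
have -> : (fun t => normc (f t)) =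
    @Num.sqrt R \o (fun t => complex.Re (f t) ^+ 2 + complex.Im (f t) ^+ 2).
  by apply/funext => t /=; case: (f t).
apply: measurableT_comp.
  by apply: continuous_measurable_fun; exact: sqrt_continuous.
by apply: measurable_funD; exact: measurable_funX.
Qed.

End closure.

Lemma cmeasurable_comp d d' (T : measurableType d) (T' : measurableType d')
  (f : T' -> C) (g : T -> T') : cmeasurable f -> measurable_fun setT g ->
  cmeasurable (f \o g).
Proof. by move=> [f1 f2] mg; split; [exact: (measurableT_comp f1 mg)|exact: (measurableT_comp f2 mg)]. Qed.

(* rounding to the grid of mesh 1 / (k + 1) *)
Let step (k : nat) (x : R) : int := Num.floor (x * k.+1%:R).

Let grid (k : nat) (z : int * int) : C :=
  Complex (z.1%:~R / k.+1%:R) (z.2%:~R / k.+1%:R).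

Let grid_near (k : nat) (z : C) :
  normc (grid k (step k (complex.Re z), step k (complex.Im z)) - z) <= 2 / k.+1%:R.
Proof.
have k0 : (0 : R) < k.+1%:R by [].
have near x : `|(step k x)%:~R / k.+1%:R - x| <= 1 / k.+1%:R.
  have /andP[h1 h2] := mem_rg1_floor (x * k.+1%:R).
  have -> : (step k x)%:~R / k.+1%:R - x = ((step k x)%:~R - x * k.+1%:R) / k.+1%:R.
    by field.
  rewrite normrM [`|_^-1|]gtr0_norm ?invr_gt0// ler_pM2r ?invr_gt0//.
  rewrite ler_norml; apply/andP; split; rewrite /step; lra.
apply: le_trans (normc_le_ReIm _) _.
rewrite cReB cImB /=; apply: le_trans (lerD (near _) (near _)) _.
by rewrite -mulrDl.
Qed.

(** f o Phi is the pointwise limit of the values of f at roundings of Phi to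
    finer and finer grids.  Each rounding takes countably many values, so that f
    of it is measurable whatever f is. *)
Lemma cmeasurable_continuous_comp d (T : measurableType d) n
    (f : 'cV[C]_n -> C) (Phi : T -> 'cV[C]_n) :
  (forall (z : 'cV[C]_n) (e : R), 0 < e -> exists2 r : R, 0 < r &
     forall w : 'cV[C]_n, (forall i, normc (w i 0 - z i 0) < r) -> normc (f w - f z) <= e) ->
  (forall i, cmeasurable (fun t => Phi t i 0)) ->
  cmeasurable (fun t => f (Phi t)).
Proof.
move=> cf mPhi.
pose label (k : nat) (t : T) : {ffun 'I_n -> int * int} :=
  [ffun i => (step k (complex.Re (Phi t i 0)), step k (complex.Im (Phi t i 0)))].
pose F k (l : {ffun 'I_n -> int * int}) : C := f (\col_i grid k (l i)).
have mstep k (h : T -> R) (j : int) : measurable_fun setT h ->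
    measurable [set t | step k (h t) = j].
  move=> mh; have mg : measurable_fun setT (fun t => h t * k.+1%:R).
    exact: measurable_funM.
  have -> : [set t | step k (h t) = j] = [set t | Num.floor (h t * k.+1%:R) = j] by [].
  have -> : [set t | Num.floor (h t * k.+1%:R) = j] =
      (fun t => h t * k.+1%:R) @^-1` `[j%:~R, (j + 1)%:~R[%classic.
    apply/seteqP; split => t /=; rewrite in_itv/=.
      move=> <-; exact: floor_itv.
    by move=> ?; exact: floor_def.
  by rewrite -[X in measurable X]setTI; exact: mg.
have mlabel k (A : set {ffun 'I_n -> int * int}) : measurable (label k @^-1` A).
  have -> : label k @^-1` A = \bigcup_(l in A) [set t | label k t = l].
    apply/seteqP; split => [t At|t [l Al /= lt]]; first by exists (label k t).
    by rewrite /preimage /= lt.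
  rewrite bigcup_mkcond; apply: countable_bigcupT_measurable => // l.
  case: ifP => // _.
  have -> : [set t | label k t = l] = \bigcap_(i in [set: 'I_n])
     ([set t | step k (complex.Re (Phi t i 0)) = (l i).1] `&`
      [set t | step k (complex.Im (Phi t i 0)) = (l i).2]).
    apply/seteqP; split => t /=; first by move=> <- i _; rewrite ffunE.
    move=> H; apply/ffunP => i; have [/= h1 h2] := H i I.
    by rewrite ffunE h1 h2 -surjective_pairing.
  apply: fin_bigcap_measurable => [|i _]; first exact: finite_finset.
  by have [m1 m2] := mPhi i; apply: measurableI; exact: mstep.
have mF k (G : C -> R) : measurable_fun setT (fun t => G (F k (label k t))).
  move=> _ B mB; rewrite setTI.
  exact: (mlabel k ((fun l => G (F k l)) @^-1` B)).
have lim (G : C -> R) : (forall x y, `|G x - G y| <= normc (x - y)) ->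
    measurable_fun setT (fun t => G (f (Phi t))).
  move=> lipG.
  apply: (measurable_fun_cvg (h := fun k t => G (F k (label k t)))) => // t _.
  apply/cvgrPdist_le => e e0.
  have [r r0 H] := cf (Phi t) e e0.
  near=> k.
  rewrite distrC; apply: le_trans (lipG _ _) _; apply: H => i.
  rewrite mxE ffunE; apply: le_lt_trans (grid_near _ _) _.
  rewrite ltr_pdivrMr// mulrC -ltr_pdivrMr//.
  near: k; have [N _ HN] := nbhs_infty_gtr (2 / r).
  by exists N => // k /= Nk; apply: HN; exact: leqW.
split.
  by apply: lim => x y; rewrite -cReB; exact: normc_Re.
by apply: lim => x y; rewrite -cImB; exact: normc_Im.
Unshelve. all: end_near. Qed.

End complex_measurable.
(** * Measure-preserving maps and translations *)
Section measure_preserving.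
Context {R : realType}.
Local Open Scope ereal_scope.

Definition preserves d (T : measurableType d) (m : set T -> \bar R) (f : T -> T) :=
  measurable_fun setT f /\ forall A, measurable A -> m (f @^-1` A) = m A.

Lemma ge0_integral_preserves d (T : measurableType d)
    (m : {measure set T -> \bar R}) phi (f : T -> \bar R) :
  preserves m phi -> measurable_fun setT f -> (forall t, 0 <= f t) ->
  \int[m]_t f (phi t) = \int[m]_t f t.
Proof.
move=> [mphi pphi] mf f0.
pose phi' : {mfun T >-> T} := HB.pack phi (isMeasurableFun.Build _ _ _ _ _ mphi).
transitivity (\int[pushforward m phi']_t f t).
  by rewrite (ge0_integral_pushforward mphi).
by apply: eq_measure_integral => A mA _; exact: pphi.
Qed.

Lemma integral_preserves d (T : measurableType d)
    (m : {measure set T -> \bar R}) phi (f : T -> \bar R) :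
  preserves m phi -> measurable_fun setT f ->
  \int[m]_t f (phi t) = \int[m]_t f t.
Proof.
move=> pphi mf; rewrite integralE [RHS]integralE; congr (_ - _).
  apply: etrans (ge0_integral_preserves pphi (measurable_funepos mf)
    (fun t => funepos_ge0 f t)).
  by apply: eq_integral => t _; rewrite !funeposE.
apply: etrans (ge0_integral_preserves pphi (measurable_funeneg mf)
    (fun t => funeneg_ge0 f t)).
by apply: eq_integral => t _; rewrite !funenegE.
Qed.

Lemma preserves_prod d1 d2 (T1 : measurableType d1) (T2 : measurableType d2)
    (m1 : {sigma_finite_measure set T1 -> \bar R})
    (m2 : {sigma_finite_measure set T2 -> \bar R}) f1 f2 :
  preserves m1 f1 -> preserves m2 f2 ->
  preserves (m1 \x m2) (fun x => (f1 x.1, f2 x.2)).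
Proof.
move=> [mf1 p1] [mf2 p2].
have mf : measurable_fun setT (fun x : T1 * T2 => (f1 x.1, f2 x.2)).
  apply/measurable_fun_pairP; split.
    exact: (measurableT_comp mf1 measurable_fst).
  exact: (measurableT_comp mf2 measurable_snd).
split=> // A mA; apply/esym.
pose f' : {mfun _ >-> _} := HB.pack (fun x : T1 * T2 => (f1 x.1, f2 x.2))
  (isMeasurableFun.Build _ _ _ _ _ mf).
apply: (@product_measure_unique _ _ _ _ _ m1 m2 (pushforward (m1 \x m2) f')) => // B C mB mC.
transitivity ((m1 \x m2) ((f1 @^-1` B) `*` (f2 @^-1` C))) => //.
have mB' : measurable (f1 @^-1` B).
  by rewrite -[X in measurable X]setTI; exact: mf1.
have mC' : measurable (f2 @^-1` C).
  by rewrite -[X in measurable X]setTI; exact: mf2.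
apply: etrans (product_measure1E _ _ mB' mC') _.
by congr (_ * _); [exact: p1|exact: p2].
Qed.

Lemma lebesgue_preserves_shift (a : R) :
  preserves (@lebesgue_measure R) (fun x : measurableTypeR R => (x + a)%R : measurableTypeR R).
Proof.
have mf : measurable_fun setT (fun x : measurableTypeR R => (x + a)%R : measurableTypeR R).
  exact: measurable_funD.
split=> // A mA.
pose f' : {mfun _ >-> _} := HB.pack (fun x : measurableTypeR R => (x + a)%R : measurableTypeR R)
  (isMeasurableFun.Build _ _ _ _ _ mf).
apply/esym/(@lebesgue_measure_unique R (pushforward (@lebesgue_measure R) f')) => //= _ [[b c]] _ <-.
rewrite /pushforward /=.
rewrite (_ : _ @^-1` _ = `]b - a, c - a]%classic)%R; last first.
  by apply/seteqP; split => x /=; rewrite !in_itv/= ltrBlDr lerBrDr.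
rewrite !lebesgue_measure_itv/= !lte_fin ltrD2r -!EFinB.
by case: ifP => // _; congr (_%:E); ring.
Qed.

End measure_preserving.

Lemma measurable_box d (T : measurableType d) k (A : 'I_k -> set T) :
  (forall i, measurable (A i)) ->
  measurable [set t : k.-tuple T | forall i, A i (tnth t i)].
Proof.
move=> mA; rewrite (_ : mkset _ = \bigcap_(i in [set: 'I_k])
    ((fun t : k.-tuple T => tnth t i) @^-1` A i)); last first.
  by apply/seteqP; split => t /= At i => [_|]; exact: At.
apply: (@fin_bigcap_measurable _ (k.-tuple T) _ [set: 'I_k]) => [|i _].
  exact: finite_finset.
by rewrite -[X in measurable X]setTI; exact: measurable_tnth.
Qed.

Section tuple_translation.
Context {R : realType}.
Local Notation T := (measurableTypeR R).

Definition tuple_add n (t v : n.-tuple T) : n.-tuple T :=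
  [tuple (tnth t i + tnth v i)%R | i < n].

Lemma measurable_tuple_add d (X : measurableType d) n (f g : X -> n.-tuple T) :
  measurable_fun setT f -> measurable_fun setT g ->
  measurable_fun setT (fun x => tuple_add (f x) (g x)).
Proof.
move=> mf mg; apply/measurable_fun_tnthP => i.
rewrite (_ : _ \o _ = fun x => tnth (f x) i + tnth (g x) i)%R; last first.
  by apply/funext => x /=; rewrite tnth_mktuple.
by apply: measurable_funD;
  [exact: (measurableT_comp (measurable_tnth i) mf)
  |exact: (measurableT_comp (measurable_tnth i) mg)].
Qed.

Lemma tuple_measure_translation n (v : n.-tuple T) :
  preserves (tuple_measure (@lebesgue_measure R) n) (fun t => tuple_add t v).
Proof.
elim: n v => [|n IH] v.
  have E (t : 0.-tuple T) : t = [tuple] by apply: val_inj; case: t => -[].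
  split; first by apply: measurable_tuple_add => //; exact: measurable_cst.
  move=> A mA; rewrite (_ : _ @^-1` _ = A)//.
  by apply/seteqP; split => t /=; rewrite (E (tuple_add t v)) (E t).
have mT : measurable_fun setT (fun t => tuple_add t v).
  by apply: measurable_tuple_add => //; exact: measurable_cst.
split=> // A mA.
rewrite /= /measure_cons /pushforward.
have [_ p] := preserves_prod (lebesgue_preserves_shift (thead v))
  (IH [tuple of behead v]).
rewrite -[RHS]p; last first.
  by rewrite -[X in measurable X]setTI; exact: measurable_tuple_cons.
congr (product_measure1 _ _ _); apply/seteqP.
have E (x : T) (t : n.-tuple T) : tuple_add (tuple_cons (x, t)) v =
    tuple_cons ((x + thead v)%R, tuple_add t [tuple of behead v]).
  apply: eq_from_tnth => i; rewrite tnth_mktuple /tuple_cons /=.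
  case: (unliftP ord0 i) => [j|] ->; last by rewrite !tnth0.
  rewrite !tnthS tnth_mktuple; congr (_ + _)%R.
  by rewrite [in LHS](tuple_eta v) tnthS.
by split => -[x t] /=; rewrite E.
Qed.

End tuple_translation.
(** * Real coordinates on C^n *)
Section coordinates.
Context {R : realType} {n : nat}.
Local Notation C := (R[i]).
Local Notation Cn := ('cV[C]_n).
Local Notation X := ((n + n).-tuple (measurableTypeR R)).

Definition of_Cn (z : Cn) : X :=
  [tuple (match fintype.split i with
          | inl j => complex.Re (z j 0)
          | inr j => complex.Im (z j 0)
          end : measurableTypeR R) | i < n + n].

Lemma to_CnK : cancel (@to_Cn R n) of_Cn.
Proof.
move=> t; apply: eq_from_tnth => i; rewrite tnth_mktuple.
by case: splitP => j ij; rewrite mxE /=; congr tnth; apply: val_inj.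
Qed.

Lemma of_CnK : cancel of_Cn (@to_Cn R n).
Proof.
move=> z; apply/matrixP => i j; rewrite mxE !tnth_mktuple (ord1 j).
have -> : fintype.split (lshift n i) = inl i by exact: (unsplitK (inl i)).
have -> : fintype.split (rshift n i) = inr i by exact: (unsplitK (inr i)).
by case: (z i 0).
Qed.

Lemma to_Cn_add (s t : X) : to_Cn (tuple_add s t) = to_Cn s + to_Cn t.
Proof. by apply/matrixP => i j; rewrite !mxE !tnth_mktuple. Qed.

Lemma cmeasurable_to_Cn (i : 'I_n) : cmeasurable (fun t : X => to_Cn t i 0).
Proof.
split.
  rewrite (_ : _ \o _ = @tnth _ _ ^~ (lshift n i)); first exact: measurable_tnth.
  by apply/funext => t; rewrite /= mxE.
rewrite (_ : _ \o _ = @tnth _ _ ^~ (rshift n i)); first exact: measurable_tnth.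
by apply/funext => t; rewrite /= mxE.
Qed.

Lemma measurable_of_Cn d (T : measurableType d) (f : T -> Cn) :
  (forall i, cmeasurable (fun t => f t i 0)) ->
  measurable_fun setT (fun t => of_Cn (f t)).
Proof.
move=> mf; apply/measurable_fun_tnthP => i.
case E : (fintype.split i) => [j|j].
  rewrite (_ : _ \o _ = fun t => complex.Re (f t j 0)); first by case: (mf j).
  by apply/funext => t; rewrite /= tnth_mktuple E.
rewrite (_ : _ \o _ = fun t => complex.Im (f t j 0)); first by case: (mf j).
by apply/funext => t; rewrite /= tnth_mktuple E.
Qed.

Lemma sqnormE (z : Cn) : sqnorm z = \sum_j Normc.normc (z j 0) ^+ 2.
Proof.
rewrite /sqnorm /cdot -[RHS]/(complex.Re (\sum_j Normc.normc (z j 0) ^+ 2)%:C%C).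
congr complex.Re; rewrite rmorph_sum; apply: eq_bigr => j _ /=.
rewrite normcE2; case: (z j 0) => a b; apply: complex_eq => /=; ring.
Qed.

Lemma sqnorm_to_Cn (t : X) : sqnorm (to_Cn t) = \sum_i tnth t i ^+ 2.
Proof.
rewrite sqnormE big_split_ord /= -big_split /=; apply: eq_bigr => j _.
by rewrite normcE2 mxE.
Qed.

Lemma sqnorm_ge0 (z : Cn) : 0 <= sqnorm z.
Proof. by rewrite sqnormE sumr_ge0// => j _; exact: sqr_ge0. Qed.

Lemma cdotE (w z : Cn) : cdot w z = (z ^t* *m w) 0 0.
Proof.
rewrite /cdot mxE; apply: eq_bigr => j _.
by rewrite !mxE mulrC.
Qed.

Lemma sqnorm_unitary (U : 'M[C]_n) (z : Cn) : U \is unitarymx ->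
  sqnorm (U *m z) = sqnorm z.
Proof.
move=> /unitarymxP Uu; rewrite /sqnorm !cdotE trmx_mul map_mxM.
by rewrite mulmxA -(mulmxA _ _ U) (mulmx1C Uu) mulmx1.
Qed.

End coordinates.
(** * Unitary invariance of Lebesgue measure *)
Section unitary_invariance.
Context {R : realType} {n : nat}.
Local Notation C := (R[i]).
Local Notation Cn := ('cV[C]_n).
Local Notation X := ((n + n).-tuple (measurableTypeR R)).
Local Notation m := (lebesgue_Cn R n).

Definition act (A : 'M[C]_n) (t : X) : X := of_Cn (A *m to_Cn t).

Lemma cmeasurable_mulmx d (T : measurableType d) (A : T -> 'M[C]_n) (f : T -> Cn) :
  (forall i j, cmeasurable (fun t => A t i j)) ->
  (forall i, cmeasurable (fun t => f t i 0)) ->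
  forall i, cmeasurable (fun t => (A t *m f t) i 0).
Proof.
move=> mA mf i.
rewrite (_ : (fun t => _) = fun t => \sum_j A t i j * f t j 0); last first.
  by apply/funext => t; rewrite mxE.
by apply: cmeasurable_sum => j; exact: cmeasurableM.
Qed.

Lemma measurable_act (A : 'M[C]_n) : measurable_fun setT (act A).
Proof.
apply: measurable_of_Cn => i; apply: cmeasurable_mulmx => [j k|j].
  exact: cmeasurable_cst.
exact: cmeasurable_to_Cn.
Qed.

Lemma actM (A B : 'M[C]_n) (t : X) : act A (act B t) = act (A *m B) t.
Proof. by rewrite /act of_CnK mulmxA. Qed.

Lemma act1 (t : X) : act 1%:M t = t.
Proof. by rewrite /act mul1mx to_CnK. Qed.

Lemma to_Cn_act (A : 'M[C]_n) (t : X) : to_Cn (act A t) = A *m to_Cn t.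
Proof. exact: of_CnK. Qed.

Lemma act_add (A : 'M[C]_n) (s t : X) :
  act A (tuple_add s t) = tuple_add (act A s) (act A t).
Proof.
apply: (can_inj to_CnK); rewrite (to_Cn_act A) (to_Cn_add s) (to_Cn_add (act A s)).
by rewrite (to_Cn_act A s) (to_Cn_act A t) mulmxDr.
Qed.

Definition tuple_opp (t : X) : X := [tuple (- tnth t i)%R | i < n + n].

Lemma measurable_tuple_opp : measurable_fun setT tuple_opp.
Proof.
apply/measurable_fun_tnthP => i.
rewrite (_ : _ \o _ = fun t => - tnth t i)%R; last first.
  by apply/funext => t /=; rewrite tnth_mktuple.
by apply: measurable_funN; exact: measurable_tnth.
Qed.

Lemma to_Cn_opp (t : X) : to_Cn (tuple_opp t) = - to_Cn t.
Proof. by apply/matrixP => i j; rewrite !mxE !tnth_mktuple. Qed.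

Lemma tuple_addC (s t : X) : tuple_add s t = tuple_add t s.
Proof. by apply: eq_from_tnth => i; rewrite !tnth_mktuple addrC. Qed.

Lemma tuple_addK (s t : X) : tuple_add (tuple_add s t) (tuple_opp t) = s.
Proof. by apply: eq_from_tnth => i; rewrite !tnth_mktuple addrK. Qed.

(** The squared radius 2 n makes the unit box a part of the ball, hence a lower
    bound of its measure. *)
Definition cball : set X := [set t | sqnorm (to_Cn t) <= (n + n)%:R].

Lemma measurable_sqnorm d (T : measurableType d) (f : T -> Cn) :
  (forall i, cmeasurable (fun t => f t i 0)) ->
  measurable_fun setT (fun t => sqnorm (f t)).
Proof.
move=> mf; rewrite (_ : (fun t => _) = fun t => \sum_i Normc.normc (f t i 0) ^+ 2).
  apply: measurable_sum => i; apply: measurable_funX.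
  exact: (@cmeasurable_normc _ _ _ (fun t => f t i 0)).
by apply/funext => t; rewrite sqnormE.
Qed.

Lemma measurable_cball : measurable cball.
Proof.
have h := measurable_sqnorm (fun i => cmeasurable_to_Cn i).
rewrite (_ : cball = (fun t : X => sqnorm (to_Cn t)) @^-1` `]-oo, (n + n)%:R]%classic).
  by rewrite -[X in measurable X]setTI; exact: h.
by apply/seteqP; split => t; rewrite /cball /= in_itv.
Qed.

Lemma sqnormN (z : Cn) : sqnorm (- z) = sqnorm z.
Proof.
by rewrite !sqnormE; apply: eq_bigr => j _; rewrite mxE; case: (z j 0) => a b /=; rewrite !sqrrN.
Qed.

Lemma unit_box_measure : m [set t | forall i, `[0, 1]%classic (tnth t i)] = 1%E.
Proof.
apply: etrans (@tuple_measure_box _ _ R (@lebesgue_measure R) (n + n)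
  (fun=> `[0, 1]%classic) (fun=> measurable_itv _)) _.
rewrite (eq_bigr (fun=> 1%E)) ?big1_eq// => i _.
by rewrite [LHS]lebesgue_measure_itv/= lte_fin ltr01 oppr0 adde0.
Qed.

Lemma cball_measure : (0 < m cball)%E /\ (m cball < +oo)%E.
Proof.
have mbox (a b : R) : measurable ([set t : X | forall i, `[a, b]%classic (tnth t i)] : set X).
  exact: (measurable_box (fun=> measurable_itv _)).
split.
  apply: (@lt_le_trans _ _ (m [set t | forall i, `[0, 1]%classic (tnth t i)])).
    by rewrite unit_box_measure lte01.
  apply: (le_measure m (mem_set (mbox 0 1)) (mem_set measurable_cball)).
  move=> t /= t01; rewrite /cball /= sqnorm_to_Cn.
  apply: (@le_trans _ _ (\sum_(i < n + n) 1)); last by rewrite sumr_const card_ord.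
  apply: ler_sum => i _; have := t01 i; rewrite /= in_itv/= => /andP[t0 t1].
  by rewrite expr_le1.
set b := ((n + n)%:R + 1 : R).
apply: (@le_lt_trans _ _ (m [set t | forall i, `[- b, b]%classic (tnth t i)])).
  apply: (le_measure m (mem_set measurable_cball) (mem_set (mbox (- b) b))).
  move=> t; rewrite /cball /= sqnorm_to_Cn => tn i; rewrite in_itv/=.
  have ti : tnth t i ^+ 2 <= (n + n)%:R.
    apply: le_trans tn; rewrite (bigD1 i)//= lerDl.
    by apply: sumr_ge0 => j _; exact: sqr_ge0.
  rewrite -ler_norml -(ler_pXn2r (ltn0Sn 1)) ?nnegrE//; last by rewrite /b addr_ge0.
  rewrite real_normK ?num_real//; apply: le_trans ti _.
  rewrite /b sqrrD1; have : (0 : R) <= (n + n)%:R by [].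
  move: ((n + n)%:R : R) => x x0; have := sqr_ge0 x; lra.
rewrite [X in (X < _)%E](@tuple_measure_box _ _ R (@lebesgue_measure R) (n + n)
  (fun=> `[- b, b]%classic) (fun=> measurable_itv _)).
rewrite (eq_bigr (fun=> (b + b)%:E)).
  by rewrite prodEFin ltry.
move=> i _; rewrite [LHS]lebesgue_measure_itv/= lte_fin.
have b0 : 0 < b by rewrite /b ltr_wpDl.
by rewrite ifT; [rewrite -EFinB opprK|lra].
Qed.

(** For B the inverse of a unitary A, the hypothesis is invariance of the norm:
    s lies in the ball around A t iff t lies in the ball around B s. *)
Lemma cballB (A B : 'M[C]_n) (s t : X) :
  sqnorm (to_Cn s - A *m to_Cn t) = sqnorm (to_Cn t - B *m to_Cn s) ->
  cball (tuple_add s (tuple_opp (act A t))) <->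
  cball (tuple_add t (tuple_opp (act B s))).
Proof.
have E (D : 'M[C]_n) (a b : X) : cball (tuple_add a (tuple_opp (act D b))) <->
    sqnorm (to_Cn a - D *m to_Cn b) <= (n + n)%:R.
  by rewrite /cball /= to_Cn_add to_Cn_opp to_Cn_act.
move=> st; apply: iff_trans (E A s t) _; rewrite st.
exact: iff_sym (E B t s).
Qed.

Local Open Scope ereal_scope.

(** Let Q be a ball about the origin.  The set of pairs (x, y) with y in Q and
    U x + y in B is measured by integrating in x first, which gives
    m (U^-1 B) m Q; after the translation of y by U x it is the set of pairs with
    y in B and y - U x in Q, and integrating in x first gives m Q m B, as
    y - U x in Q means x - U^-1 y in Q.  As 0 < m Q < +oo, it cancels. *)
Lemma unitary_preserves (U : 'M[C]_n) : U \is unitarymx -> preserves m (act U).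
Proof.
move=> Uu; split; first exact: measurable_act.
move=> B mB.
pose V := U ^t*.
have UV : U *m V = 1%:M by apply/unitarymxP.
have VU : V *m U = 1%:M by exact: mulmx1C.
have tr (v : X) : preserves m (fun t => tuple_add t v) by exact: tuple_measure_translation.
have mpre (f : X -> X) (A : set X) : measurable_fun setT f -> measurable A ->
    measurable (f @^-1` A).
  by move=> mf mA; rewrite -[X in measurable X]setTI; exact: mf.
pose E : set (X * X) := [set xy | cball xy.2 /\ B (tuple_add (act U xy.1) xy.2)].
pose E' : set (X * X) := [set xy | B xy.2 /\ cball (tuple_add xy.2 (tuple_opp (act U xy.1)))].
have mU1 : measurable_fun setT (fun xy : X * X => act U xy.1).
  exact: (measurableT_comp (measurable_act U) measurable_fst).
have mE : measurable E.
  apply: (@measurableI _ _ (snd @^-1` cball)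
    ((fun xy : X * X => tuple_add (act U xy.1) xy.2) @^-1` B)).
    rewrite -[X in measurable X]setTI; apply: measurable_snd => //; exact: measurable_cball.
  rewrite -[X in measurable X]setTI.
  by apply: (measurable_tuple_add mU1 measurable_snd) => //.
have mE' : measurable E'.
  apply: (@measurableI _ _ (snd @^-1` B)
    ((fun xy : X * X => tuple_add xy.2 (tuple_opp (act U xy.1))) @^-1` cball)).
    rewrite -[X in measurable X]setTI; exact: measurable_snd.
  rewrite -[X in measurable X]setTI.
  apply: (measurable_tuple_add measurable_snd (measurableT_comp measurable_tuple_opp mU1)) => //.
  exact: measurable_cball.
have swap (F : set (X * X)) : measurable F -> (m \x m) F = (m \x^ m) F.
  move=> mF; apply: product_measure_unique => // A1 A2 mA1 mA2.
  exact: product_measure2E.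
have cancelU (x y : X) : tuple_add (act U x) y = act U (tuple_add x (act V y)).
  by rewrite act_add actM UV act1.
have ballP (x y : X) : cball (tuple_add y (tuple_opp (act U x))) <->
    cball (tuple_add x (tuple_opp (act V y))).
  apply: cballB; rewrite -[RHS](sqnorm_unitary _ Uu).
  by rewrite mulmxBr mulmxA UV mul1mx -sqnormN opprB.
have L1 : (m \x^ m) E = m (act U @^-1` B) * m cball.
  rewrite /product_measure2.
  transitivity (\int[m]_y ((cst (m (act U @^-1` B)) \_ cball) y)).
    apply: eq_integral => y _; rewrite /patch /=.
    case: ifPn; rewrite ?inE ?notin_setE => yQ.
      have [_ p] := tr (act V y).
      apply: etrans (p _ (mpre _ _ (measurable_act U) mB)).
      congr (m _); apply/seteqP; split => x; rewrite /ysection /= ?inE /E /=.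
        by rewrite cancelU => -[].
      by rewrite cancelU.
    rewrite (_ : ysection E y = set0) ?measure0//.
    by apply/seteqP; split => x//; rewrite /ysection /= inE /E /= => -[].
  rewrite -integral_mkcond integral_cst//; exact: measurable_cball.
have L2 : (m \x^ m) E' = m cball * m B.
  rewrite /product_measure2.
  transitivity (\int[m]_y ((cst (m cball) \_ B) y)).
    apply: eq_integral => y _; rewrite /patch /=.
    case: ifPn; rewrite ?inE ?notin_setE => yB.
      have [_ p] := tr (tuple_opp (act V y)).
      apply: etrans (p _ measurable_cball).
      congr (m _); apply/seteqP; split => x; rewrite /ysection /= ?inE /E' /=.
        by case=> _; exact: (ballP x y).1.
      by move=> xQ; exact: (conj yB ((ballP x y).2 xQ)).
    rewrite (_ : ysection E' y = set0) ?measure0//.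
    by apply/seteqP; split => x//; rewrite /ysection /= inE /E' /= => -[].
  by rewrite -integral_mkcond integral_cst.
have L3 : (m \x m) E = (m \x m) E'.
  rewrite /product_measure1; apply: eq_integral => x _ /=.
  have [_ p] := tr (act U x).
  apply: etrans (p _ (measurable_xsection x mE')).
  congr (m _); apply/seteqP; split => y; rewrite /xsection /= !inE /E /E' /= tuple_addK.
    by rewrite (tuple_addC (act U x)) => -[].
  by rewrite (tuple_addC (act U x)) => -[].
have : m (act U @^-1` B) * m cball = m B * m cball.
  apply: etrans (esym L1) _; apply: etrans (esym (swap _ mE)) _.
  apply: etrans L3 _; apply: etrans (swap _ mE') _.
  by apply: etrans L2 _; rewrite muleC.
have [Q0 Qoo] := cball_measure.
have Qfin : m cball \is a fin_num by rewrite ge0_fin_numE// ltW.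
move=> h; apply/eqP; rewrite eq_le -(lee_pmul2r Qfin Q0) h lexx.
by rewrite -(lee_pmul2r Qfin Q0) h lexx.
Qed.

End unitary_invariance.
(** * Weights grow at least linearly *)
Section half_line_calculus.
Context {R : realType}.
Implicit Types f : R -> R.

Lemma derivable_ge0_estimate f (y e : R) : derivable_ge0 f -> 0 <= y -> 0 < e ->
  exists2 r : R, 0 < r & forall x, 0 <= x -> `|x - y| < r ->
    `|f x - f y - derive_ge0 f y * (x - y)| <= e * `|x - y|.
Proof.
move=> df y0 e0; have /cvgrPdist_le /(_ _ e0) := df y y0.
rewrite /near_ge0 -/(derive_ge0 f y) => -[r /= r0 H]; exists r => // x x0 xr.
have [->|xy] := eqVneq x y; first by rewrite !subrr mulr0 subrr normr0 mulr0.
have := H x; rewrite /= distrC => /(_ xr xy); rewrite in_itv/= andbT => /(_ x0).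
rewrite /quotient_ge0 distrC => h.
have xy0 : x - y != 0 by rewrite subr_eq0.
have -> : f x - f y - derive_ge0 f y * (x - y) =
    ((f x - f y) / (x - y) - derive_ge0 f y) * (x - y) by field.
by rewrite normrM ler_wpM2r.
Qed.

Lemma derivable_ge0_continuous f : derivable_ge0 f ->
  {within `[0, +oo[, continuous f}.
Proof.
move=> df; apply/subspace_continuousP => y /=; rewrite in_itv/= andbT => y0.
apply/cvgrPdist_le => /= e e0.
have [r r0 H] := derivable_ge0_estimate df y0 ltr01.
have d0 : 0 < 1 + `|derive_ge0 f y| by rewrite ltr_pwDl.
exists (Num.min r (e / (1 + `|derive_ge0 f y|))) => /=.
  by rewrite lt_min r0 divr_gt0.
move=> x /=; rewrite lt_min distrC => /andP[xr xe]; rewrite in_itv/= andbT => x0.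
rewrite distrC; have h := H x x0 xr.
have -> : f x - f y = (f x - f y - derive_ge0 f y * (x - y)) + derive_ge0 f y * (x - y).
  by ring.
apply: le_trans (ler_normD _ _) _; rewrite normrM.
by move: xe; rewrite ltr_pdivlMr//; lra.
Qed.

Lemma derivable_ge0_is_derive f (y : R) : derivable_ge0 f -> 0 < y ->
  is_derive y 1 f (derive_ge0 f y).
Proof.
move=> df y0.
have cv : (fun h : R => h^-1 *: (f (h *: 1 + y) - f y)) @ 0^' --> derive_ge0 f y.
  apply/cvgrPdist_le => e e0.
  have [r r0 H] := derivable_ge0_estimate df (ltW y0) e0.
  exists (Num.min r y) => /=; first by rewrite lt_min r0 y0.
  move=> h /=; rewrite sub0r normrN lt_min => /andP[hr hy] h0.
  rewrite [h%:A]mulr1.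
  have hy0 : 0 <= h + y by have := ler_norm (- h); rewrite normrN; lra.
  have := H (h + y) hy0; rewrite addrK => /(_ hr) E.
  have -> : derive_ge0 f y - h^-1 * (f (h + y) - f y) =
    - (f (h + y) - f y - derive_ge0 f y * h) / h by field.
  by rewrite normrM normrN normfV ler_pdivrMr// normr_gt0.
by split; [apply/cvg_ex; exists (derive_ge0 f y)|exact/cvg_lim].
Qed.

Lemma mean_value_ge0 f (y : R) : derivable_ge0 f -> 0 < y ->
  exists2 c, 0 < c & f y - f 0 = derive_ge0 f c * y.
Proof.
move=> df y0.
have [||c] := @MVT R f (derive_ge0 f) 0 y y0.
- by move=> x; rewrite in_itv/= => /andP[x0 _]; exact: derivable_ge0_is_derive.
- apply: continuous_subspaceW (derivable_ge0_continuous df) => x /=.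
  by rewrite !in_itv/= andbT => /andP[].
by rewrite in_itv/= => /andP[c0 _] ->; exists c; rewrite ?subr0.
Qed.

Lemma weight_continuous n (psi : R -> R) : weight n psi ->
  {within `[0, +oo[, continuous psi}.
Proof.
move=> [_ [Dpsi _] _ _]; apply: derivable_ge0_continuous; exact: (Dpsi 0%N).
Qed.

(** psi' is nondecreasing, so two applications of the mean value theorem give
    psi y >= psi 0 + psi' 0 * y. *)
Lemma weight_linear_growth n (psi : R -> R) : weight n psi ->
  exists2 a : R, 0 < a & forall y, 0 <= y -> a * y <= psi y.
Proof.
move=> [psi0 [Dpsi _] pos _].
have [a0 _ _] := pos 0 (lexx _).
exists (derive_ge0 psi 0) => // y; rewrite le_eqVlt => /predU1P[<-|y0].
  by rewrite mulr0 psi0.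
have [c c0 E] := mean_value_ge0 (Dpsi 0%N isT) y0.
have [c' c'0 E'] := mean_value_ge0 (Dpsi 1%N isT) c0.
have [_ h _] := pos c' (ltW c'0).
have psi00 := psi0 0 (lexx _).
have : derive_ge0 psi 0 <= derive_ge0 psi c.
  by rewrite -subr_ge0 [X in _ <= X]E' mulr_ge0// ltW.
rewrite -(ler_pM2r y0) -E; rewrite /derive_ge0n /= in psi00 *; lra.
Qed.

End half_line_calculus.

(** * Gaussian integrals *)
Section gaussian.
Context {R : realType}.

Lemma gaussian_integral_lty (b : R) : 0 < b ->
  (\int[@lebesgue_measure R]_x (expR (- (b * x ^+ 2)))%:E < +oo)%E.
Proof.
move=> b0.
(* the Gaussian is a multiple of the centred normal density of variance s ^+ 2 *)
pose s := Num.sqrt (2 * b)^-1.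
have s0 : s != 0 by rewrite gt_eqF// sqrtr_gt0 invr_gt0 mulr_gt0.
have s2 : s ^+ 2 = (2 * b)^-1 by rewrite sqr_sqrtr// invr_ge0 mulr_ge0// ltW.
have p0 := normal_peak_gt0 s0.
have E x : expR (- (b * x ^+ 2)) = (normal_peak s)^-1 * normal_pdf 0 s x.
  rewrite normal_pdfE// /= /normal_fun subr0 s2.
  rewrite mulKf ?gt_eqF//; congr expR; rewrite -mulr_natr.
  by field; rewrite gt_eqF.
have : (@lebesgue_measure R).-integrable setT
    (fun x => ((normal_peak s)^-1%:E * (normal_pdf 0 s x)%:E)%E).
  by apply: integrableZl => //; exact: integrable_normal_pdf.
move=> /integrableP[_]; apply: le_lt_trans.
apply: ge0_le_integral => //=.
- apply/measurable_EFinP; apply: measurableT_comp => //.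
  by apply: measurable_funN; apply: measurable_funM => //; exact: measurable_funX.
- apply/measurable_EFinP; apply: measurableT_comp => //.
  by apply: measurable_funM => //; exact: measurable_normal_pdf.
- by move=> x _; rewrite E lee_fin ler_norm.
Qed.

Lemma tuple_gaussian_integral_lty (b : R) n : 0 < b ->
  (\int[tuple_measure (@lebesgue_measure R) n]_t
     (expR (- (b * \sum_i tnth t i ^+ 2)))%:E < +oo)%E.
Proof.
move=> b0.
have mG k : measurable_fun setT (fun t : k.-tuple (measurableTypeR R) =>
   (expR (- (b * \sum_i tnth t i ^+ 2)))%:E).
  apply/measurable_EFinP; apply: measurableT_comp => //; apply: measurable_funN.
  apply: measurable_funM => //; apply: measurable_sum => i.
  by apply: measurable_funX; exact: measurable_tnth.
elim: n => [|n IH].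
  rewrite [X in (X < _)%E]integral_dirac//; last exact: mG.
  by rewrite diracT mul1e ltry.
set F := fun t : n.+1.-tuple (measurableTypeR R) =>
  (expR (- (b * \sum_i tnth t i ^+ 2)))%:E.
have mF : measurable_fun setT F := mG _.
have F0 t : (0 <= F t)%E by rewrite lee_fin expR_ge0.
rewrite /= [X in (X < _)%E](_ : _ = \int[((@lebesgue_measure R) \x
    (tuple_measure (@lebesgue_measure R) n))%E]_x F (tuple_cons x))%E; last first.
  exact: (ge0_integral_pushforward (@measurable_tuple_cons _ _ n)).
rewrite fubini_tonelli1//; last first.
  exact: measurableT_comp mF (@measurable_tuple_cons _ _ n).
set I := (\int[tuple_measure (@lebesgue_measure R) n]_t
     (expR (- (b * \sum_i tnth t i ^+ 2)))%:E)%E in IH *.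
have I0 : (0 <= I)%E by apply: integral_ge0 => t _; rewrite lee_fin expR_ge0.
rewrite /fubini_F (_ : (\int[_]_x _)%E = (\int[@lebesgue_measure R]_x ((expR (- (b * x ^+ 2)))%:E * I))%E).
  have Ifin : I \is a fin_num by rewrite ge0_fin_numE.
  rewrite -(fineK Ifin) ge0_integralZr//.
  - have G0 : (0 <= \int[@lebesgue_measure R]_x (expR (- (b * x ^+ 2)))%:E)%E.
      by apply: integral_ge0 => x _; rewrite lee_fin expR_ge0.
    apply: lte_mul_pinfty; [exact: G0| |exact: ltry].
    by rewrite ge0_fin_numE//; exact: gaussian_integral_lty.
  - apply/measurable_EFinP; apply: measurableT_comp => //.
    by apply: measurable_funN; apply: measurable_funM => //; exact: measurable_funX.
  - by rewrite lee_fin fine_ge0.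
apply: eq_integral => x _; rewrite /I -ge0_integralZl//; last exact: mG.
apply: eq_integral => t _; rewrite -EFinM -expRD /F; congr (expR _)%:E.
rewrite big_ord_recl /tuple_cons /= tnth0 -opprD -mulrDr; congr (- (b * (_ + _))).
by apply: eq_bigr => i _; rewrite tnthS.
Qed.

End gaussian.
(** * Singular values of a contraction *)
Section singular_values.
Context {R : realType} {n : nat}.
Local Notation C := (R[i]).
Local Notation Cn := ('cV[C]_n).
Local Notation rdiag s := (diag_mx (\row_j ((s j)%:C%C : C))).

(** A supremum bounds a set only if the set is bounded above; here the bound K is
    the sum of the squared l^1 norms of the rows of A. *)
Lemma opnorm_le1 (A : 'M[C]_n) (w : Cn) :
  opnorm A <= 1 -> sqnorm w <= 1 -> sqnorm (A *m w) <= 1.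
Proof.
move=> A1 w1.
have coord (v : Cn) : cnorm v <= 1 -> forall j, Normc.normc (v j 0) <= 1.
  move=> v1 j; rewrite -(ler_pXn2r (ltn0Sn 1)) ?nnegrE ?normc_ge0// expr1n.
  have : sqnorm v <= 1.
    by rewrite -(sqr_sqrtr (sqnorm_ge0 v)) expr_le1 ?sqrtr_ge0.
  apply: le_trans; rewrite sqnormE (bigD1 j)//= lerDl.
  by apply: sumr_ge0 => k _; exact: sqr_ge0.
pose K := \sum_i (\sum_j Normc.normc (A i j)) ^+ 2.
have hs : has_sup [set cnorm (A *m v) | v in [set v | cnorm v <= 1]].
  split; first by exists (cnorm (A *m w)), w => //=; rewrite /cnorm -sqrtr1 ler_sqrt.
  exists (Num.sqrt K) => _ [v /= v1 <-]; rewrite /cnorm ler_sqrt; last first.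
    by apply: sumr_ge0 => i _; exact: sqr_ge0.
  rewrite sqnormE; apply: ler_sum => i _.
  have S0 : 0 <= \sum_j Normc.normc (A i j) by apply: sumr_ge0 => j _; exact: normc_ge0.
  rewrite ler_pXn2r ?nnegrE ?normc_ge0// mxE.
  elim/big_rec2 : _ {S0} => [|j x y _ xy]; first by rewrite Normc.normc0.
  apply: le_trans (le_normcD _ _) _; apply: lerD => //.
  by rewrite Normc.normcM ler_piMr ?normc_ge0//; exact: coord.
have : cnorm (A *m w) <= 1.
  apply: le_trans A1; apply: sup_ubound; first exact: hs.2.
  by exists w => //=; rewrite /cnorm -sqrtr1 ler_sqrt.
move=> h; rewrite -(sqr_sqrtr (sqnorm_ge0 _)) expr_le1 ?sqrtr_ge0//.
Qed.

Lemma rdiag_trC (s : 'I_n -> R) : (rdiag s) ^t* = rdiag s.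
Proof.
rewrite tr_diag_mx map_diag_mx; congr diag_mx.
by apply/rowP => j; rewrite !mxE; apply: complex_eq; rewrite /= ?oppr0.
Qed.

Lemma gram_entry (W : 'M[C]_n) i j :
  (W *m W ^t*) i j = \sum_k W i k * (W j k)^*.
Proof. by rewrite mxE; apply: eq_bigr => k _; rewrite !mxE. Qed.

(** A matrix with a zero row is singular, so some unit vector is orthogonal to
    all its rows. *)
Lemma singular_orthonormal_vector (W : 'M[C]_n) k : row k W = 0 ->
  exists y : 'rV[C]_n, y *m y ^t* = 1%:M /\ W *m y ^t* = 0.
Proof.
move=> Wk.
have : \det (W ^t*) == 0.
  rewrite det_map_mx det_tr (expand_det_row _ k) big1 ?rmorph0// => j _.
  by have /rowP/(_ j) := Wk; rewrite !mxE => ->; rewrite mul0r.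
move=> /det0P[v v0 vW].
have vv : exists2 r : R, 0 < r & v *m v ^t* = (r%:C%C)%:M.
  exists (\sum_j Normc.normc (v 0 j) ^+ 2).
    have /rV0Pn[j vj] := v0; rewrite (bigD1 j)//= ltr_wpDr//.
      by apply: sumr_ge0 => i _; exact: sqr_ge0.
    rewrite exprn_gt0// lt_neqAle normc_ge0 andbT eq_sym.
    by apply: contra vj => /eqP/Normc.eq0_normc ->.
  apply/matrixP => a b; rewrite !ord1 !mxE eqxx mulr1n rmorph_sum.
  apply: eq_bigr => j _; rewrite !mxE normcE2.
  by case: (v 0 j) => x y; apply: complex_eq => /=; ring.
have [r r0 vr] := vv.
pose c : C := (Num.sqrt r)^-1%:C%C.
have cc : c^* = c by apply: complex_eq; rewrite /= ?oppr0.
exists (c *: v).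
have E : (c *: v) ^t* = c *: v ^t*.
  by apply/matrixP => i j; rewrite !mxE rmorphM/= cc.
split; last first.
  rewrite E -scalemxAr.
  have -> : W *m v ^t* = (v *m W ^t*) ^t* by rewrite trmx_mul map_mxM trmxCK.
  by rewrite vW trmx0 map_mx0 scaler0.
rewrite E -scalemxAr -scalemxAl vr scalerA scale_scalar_mx; congr (_%:M).
rewrite /c -!rmorphM -[RHS]/(1%:C%C); congr (_%:C%C).
rewrite -{3}(sqr_sqrtr (ltW r0)); field.
by rewrite gt_eqF// sqrtr_gt0.
Qed.

(** Orthogonal rows are normalized by dividing by their lengths s_j, unless
    s_j = 0.  A zero row is replaced by a unit vector orthogonal to all rows, which
    lowers the number of zero rows; multiplication by s_j = 0 restores it. *)
Lemma orthogonal_rows_unitary (W : 'M[C]_n) (s : 'I_n -> R) :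
  (forall j, 0 <= s j) -> W *m W ^t* = rdiag (fun j => s j ^+ 2) ->
  exists2 Q : 'M[C]_n, Q \is unitarymx & W = rdiag s *m Q.
Proof.
have [m] := ubnP #|[pred j | s j == 0]|.
elim: m W s => // m IH W s; rewrite ltnS => sm s0 WW.
have [/existsP[k /eqP sk]|] := boolP [exists k, s k == 0]; last first.
  rewrite negb_exists => /forallP sn0.
  exists (rdiag (fun j => (s j)^-1) *m W).
    apply/unitarymxP; rewrite trmx_mul map_mxM rdiag_trC mulmxA -(mulmxA _ W) WW.
    rewrite !mulmx_diag; apply/matrixP => i j; rewrite !mxE; congr (_ *+ _).
    rewrite -!rmorphM; congr (_%:C%C); field; exact: sn0.
  rewrite mulmxA mulmx_diag (_ : diag_mx _ = 1%:M) ?mul1mx//.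
  apply/matrixP => i j; rewrite !mxE; congr (_ *+ _).
  by rewrite -rmorphM divff//; exact: sn0.
have Wk : row k W = 0.
  have /matrixP/(_ k k) := WW; rewrite gram_entry !mxE eqxx mulr1n sk expr0n /=.
  move=> h; apply/rowP => l; rewrite !mxE.
  have : complex.Re (\sum_k0 W k k0 * (W k k0)^*) = 0 by rewrite h.
  rewrite (_ : \sum_k0 _ = (\sum_k0 Normc.normc (W k k0) ^+ 2)%:C%C); last first.
    rewrite rmorph_sum; apply: eq_bigr => j _; rewrite normcE2.
    by case: (W k j) => x y; apply: complex_eq => /=; ring.
  move=> /psumr_eq0P /(_ _)/= H; have {H}/(_ (fun j _ => sqr_ge0 _) l isT) := H.
  by move=> /eqP; rewrite sqrf_eq0 => /eqP/Normc.eq0_normc.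
have [y [yy Wy]] := singular_orthonormal_vector Wk.
pose W' : 'M[C]_n := \matrix_(i, j) if i == k then y 0 j else W i j.
pose s' j := if j == k then 1 else s j.
have yyE : \sum_j y 0 j * (y 0 j)^* = 1.
  have /matrixP/(_ 0 0) := yy; rewrite !mxE eqxx mulr1n => <-.
  by apply: eq_bigr => j _; rewrite !mxE.
have WyE i : \sum_j W i j * (y 0 j)^* = 0.
  have /matrixP/(_ i 0) := Wy; rewrite !mxE => h; apply: etrans _ h.
  by apply: eq_bigr => j _; rewrite !mxE.
have [|||Q Qu WQ] := IH W' s'.
- apply: leq_trans sm; apply: proper_card; apply/properP; split.
    by apply/fintype.subsetP => j; rewrite !inE /s'; case: ifP => //; rewrite oner_eq0.
  by exists k; rewrite !inE ?sk// /s' eqxx oner_eq0.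
- by move=> j; rewrite /s'; case: ifP.
- apply/matrixP => i j; rewrite gram_entry !mxE /s'.
  under eq_bigr do rewrite !mxE.
  have [ik|ik] := eqVneq i k; have [jk|jk] := eqVneq j k.
  + by rewrite ik jk eqxx expr1n yyE.
  + rewrite ik eq_sym (negPf jk) mulr0n.
    have := congr1 (@Num.conj C) (WyE j); rewrite rmorph0 rmorph_sum => h.
    by apply: etrans _ h; apply: eq_bigr => l _; rewrite rmorphM/= conjCK mulrC.
  + by rewrite jk (negPf ik) mulr0n WyE.
  + by have /matrixP/(_ i j) := WW; rewrite gram_entry !mxE.
exists Q => //; apply/matrixP => i j.
have /matrixP/(_ i j) := WQ; rewrite !mul_diag_mx !mxE /s'.
case: (eqVneq i k) => [->|//] _; rewrite sk mul0r.
by have /rowP/(_ j) := Wk; rewrite !mxE.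
Qed.

(** If P diagonalizes A^* A, then B = A P^* has orthogonal columns, whose lengths
    are at most 1 as A is a contraction; scaling them to length 1 gives U. *)
Lemma singular_value_decomposition (A : 'M[C]_n) :
  (forall w : Cn, sqnorm w <= 1 -> sqnorm (A *m w) <= 1) ->
  exists (U V : 'M[C]_n) (s : 'I_n -> R),
    [/\ U \is unitarymx, V \is unitarymx, forall j, 0 <= s j <= 1 &
        A = U *m rdiag s *m V].
Proof.
move=> A1; pose M := A ^t* *m A.
have Mn : M \is normalmx.
  apply/normalmxP; have -> : M ^t* = M by rewrite /M trmx_mul map_mxM trmxCK.
  by [].
have := orthomx_spectralP Mn; set P := spectralmx M; set d := spectral_diag M => ME.
have Pu : P \is unitarymx := spectral_unitarymx M.
have PP : P *m P ^t* = 1%:M by apply/unitarymxP.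
have PP' : P ^t* *m P = 1%:M by exact: mulmx1C.
pose B := A *m P ^t*.
pose s j := cnorm (col j B).
have BB : B ^t* *m B = diag_mx d.
  rewrite /B trmx_mul map_mxM trmxCK -mulmxA (mulmxA _ A) -/M ME invmx_unitary//.
  by rewrite !mulmxA PP mul1mx -mulmxA PP mulmx1.
have s1 j : 0 <= s j <= 1.
  rewrite sqrtr_ge0 /s /cnorm -[X in _ <= X]sqrtr1 ler_sqrt// /B colE -mulmxA -colE.
  apply: A1; rewrite /sqnorm cdotE colE trmx_mul map_mxM -mulmxA (mulmxA _ (P ^t*)).
  rewrite trmxCK PP mul1mx !mxE (bigD1 j)//= !mxE !eqxx big1 ?addr0 /=.
    by lra.
  by move=> i ij; rewrite !mxE (negPf ij) mulr0.
have [||Q Qu WQ] := @orthogonal_rows_unitary (B ^t*) s.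
- by move=> j; have /andP[] := s1 j.
- rewrite trmxCK BB; apply/matrixP => i j; rewrite !mxE.
  congr (_ *+ _); rewrite /s /cnorm sqr_sqrtr ?sqnorm_ge0// /sqnorm cdotE.
  have -> : ((col i B) ^t* *m col i B) 0 0 = (B ^t* *m B) i i.
    by rewrite !mxE; apply: eq_bigr => k _; rewrite !mxE.
  have -> : d 0 i = (B ^t* *m B) i i by rewrite BB mxE eqxx mulr1n.
  rewrite mxE; apply: complex_eq => //=.
  elim/big_rec : _ => // k x _; rewrite cImD => ->; rewrite addr0.
  have -> : (B ^t*) i k = (B k i)^* by rewrite !mxE.
  by case: (B k i) => a b /=; ring.
have QB : Q ^t* *m rdiag s = B.
  by rewrite -[B]trmxCK WQ trmx_mul map_mxM rdiag_trC.
exists (Q ^t*), P, s; split; [by rewrite trmxC_unitary|exact: Pu|exact: s1|].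
by rewrite QB /B -mulmxA PP' mulmx1.
Qed.

End singular_values.
(** * Blaschke matrices *)
Section blaschke.
Context {R : realType}.
Local Notation C := (R[i]).
Local Notation normc := (@Normc.normc R).

(** For 0 <= s < 1 this is the automorphism of the disc that takes 0 to s; its
    limit as s tends to 1 is the constant 1, whereas the quotient itself is
    undefined at l = -1 when s = 1. *)
Definition blaschke (s : R) (l : C) : C :=
  if s == 1 then 1 else (s%:C%C + l) / (1 + s%:C%C * l).

Lemma blaschke0 (s : R) : blaschke s 0 = s%:C%C.
Proof.
rewrite /blaschke; case: eqP => [->|_]; first by rewrite rmorph1.
by rewrite mulr0 !addr0 divr1.
Qed.

Lemma blaschke_den_neq0 (s : R) (l : C) : 0 <= s <= 1 -> s != 1 -> normc l <= 1 ->
  1 + s%:C%C * l != 0.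
Proof.
move=> /andP[s0 s1] sn1 l1; rewrite addrC addr_eq0; apply/eqP => E.
have := congr1 normc E.
rewrite Normc.normcM normc_real ger0_norm//.
have -> : normc (-1) = 1 by rewrite /= sqrrN expr1n oppr0 expr0n addr0 sqrtr1.
move=> h; have : s < 1 by rewrite lt_neqAle sn1.
have : s * normc l <= s * 1 by rewrite ler_wpM2l.
lra.
Qed.

Lemma normc_blaschke (s : R) (l : C) : 0 <= s <= 1 -> normc l = 1 ->
  normc (blaschke s l) = 1.
Proof.
move=> s01 l1; rewrite /blaschke; case: eqP => [_|/eqP sn1].
  by rewrite /= expr1n expr0n addr0 sqrtr1.
have d0 : 1 + s%:C%C * l != 0 by apply: blaschke_den_neq0 => //; rewrite l1.
rewrite Normc.normcM Normc.normcV.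
have n0 : normc (1 + s%:C%C * l) != 0 by apply: contra d0 => /eqP/Normc.eq0_normc ->.
have -> : normc (s%:C%C + l) = normc (1 + s%:C%C * l); last by rewrite divff.
apply/eqP; rewrite -(@eqrXn2 _ 2)// ?normc_ge0// !normcE2; apply/eqP.
have := congr1 (fun x => x ^+ 2) l1; rewrite normcE2 expr1n.
case: l {l1 d0 n0} => a b /= ab.
have -> : (s + a) ^+ 2 + (0 + b) ^+ 2 = (s + a) ^+ 2 + b ^+ 2 by ring.
have -> : (1 + (s * a - 0 * b)) ^+ 2 + (0 + (s * b + 0 * a)) ^+ 2 =
   (1 + s * a) ^+ 2 + s ^+ 2 * b ^+ 2 by ring.
have -> : b ^+ 2 = 1 - a ^+ 2 by rewrite -ab; ring.
ring.
Qed.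

Lemma blaschkeJ (s : R) (l : C) : (blaschke s l)^* = blaschke s l^*.
Proof.
have sJ : (s%:C%C)^* = s%:C%C :> C by apply: complex_eq; rewrite /= ?oppr0.
rewrite /blaschke; case: ifP => _; first by rewrite rmorph1.
by rewrite rmorphM fmorphV !rmorphD rmorphM rmorph1 /= sJ.
Qed.

Lemma cderiv_of_derivable (h : C -> C) (z : C) :
  derivable (h : (C : numFieldType) -> (C : numFieldType)) z 1 ->
  exists c, cderiv_at h z c.
Proof.
move=> dh; exists ('D_1 (h : (C : numFieldType) -> (C : numFieldType)) z) => e e0.
have e0' : (0 : C) < e%:C%C by rewrite ltcR.
have [r r0 H] := derivable_estimate dh e0'.
move: r0; rewrite ltcE => /andP[/eqP /= ri r0].
exists (complex.Re r) => // k kr.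
have := H k; rewrite !normC_normc.
have -> : r = (complex.Re r)%:C%C by apply: complex_eq.
by rewrite ltcR -rmorphM lecR; exact.
Qed.

Lemma derivable_blaschke_factor (s : R) (l : C) : 0 <= s <= 1 -> normc l <= 1 ->
  derivable (blaschke s : (C : numFieldType) -> (C : numFieldType)) l 1.
Proof.
move=> s01 l1; rewrite /blaschke; case: eqP => [_|/eqP sn1].
  exact: derivable_cst.
by apply: derivable_blaschke; exact: blaschke_den_neq0.
Qed.

(** The unit circle in either direction: the adjoint of a Blaschke matrix at l is
    a Blaschke matrix at the conjugate of l, so an identity between a matrix and
    its adjoint compares both directions. *)
Definition circle (b : bool) (t : R) : C := if b then (cexp 0 t)^* else cexp 0 t.

Lemma normc_circle b t : normc (circle b t) = 1.
Proof. by case: b; rewrite /circle ?normc_conj normc_cexp expR0. Qed.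

Lemma circle_mean b (h : C -> C) :
  (forall z, normc z <= 1 -> exists c, cderiv_at h z c) ->
  integrable_on 0 (2 * pi) (fun t => complex.Re (h (circle b t))) /\
  itv_int 0 (2 * pi) (fun t => complex.Re (h (circle b t))) =
    2 * pi * complex.Re (h 0).
Proof.
have main (k : C -> C) : (forall z, normc z <= 1 -> exists c, cderiv_at k z c) ->
    integrable_on 0 (2 * pi) (fun t => complex.Re (k (cexp 0 t))) /\
    itv_int 0 (2 * pi) (fun t => complex.Re (k (cexp 0 t))) =
      2 * pi * complex.Re (k 0).
  move=> dk; split; last exact: mean_value.
  apply: itv_integrable => v.
  by have [] := cauchy_riemann_continuous (cauchy_riemann_cexp dk v (lexx 0)).
case: b => dh; last exact: main.
have dh' z : normc z <= 1 -> exists c, cderiv_at (fun z => (h z^*)^*) z c.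
  move=> z1; have [|c hc] := dh z^*; first by rewrite normc_conj.
  exists c^* => e e0; have [r r0 H] := hc e e0; exists r => // k kr.
  have -> : (h (z + k)^*)^* - (h z^*)^* - c^* * k =
      (h (z^* + k^*) - h z^* - c * k^*)^*.
    by rewrite rmorphB rmorphB rmorphM /= conjCK rmorphD.
  by rewrite normc_conj -[X in _ <= _ * X]normc_conj; apply: H; rewrite normc_conj.
have [I M] := main _ dh'; move: M; rewrite cReJ rmorph0 => <-.
have E : (fun t => complex.Re (h (circle true t))) =
    fun t => complex.Re (h (cexp 0 t)^*)^*.
  by apply/funext => t; rewrite cReJ.
by rewrite E.
Qed.

Section matrix.
Variables (n : nat) (U V : 'M[C]_n) (s : 'I_n -> R).
Hypothesis s01 : forall j, 0 <= s j <= 1.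

(** A holomorphic family of matrices on the disc through U diag(s) V at l = 0,
    unitary on the circle when U and V are. *)
Definition blaschke_mx (l : C) : 'M[C]_n :=
  U *m diag_mx (\row_j blaschke (s j) l) *m V.

Lemma blaschke_mx0 : blaschke_mx 0 = U *m diag_mx (\row_j (s j)%:C%C) *m V.
Proof.
rewrite /blaschke_mx; congr (_ *m diag_mx _ *m _).
by apply/rowP => j; rewrite !mxE blaschke0.
Qed.

Lemma blaschke_mx_unitary (l : C) : U \is unitarymx -> V \is unitarymx ->
  normc l = 1 -> blaschke_mx l \is unitarymx.
Proof.
move=> Uu Vu l1; apply: mul_unitarymx Vu; apply: mul_unitarymx Uu _.
apply/unitarymxP; rewrite tr_diag_mx map_diag_mx mulmx_diag.
apply/matrixP => i j; rewrite !mxE; congr (_ *+ _).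
have /(congr1 (fun x => x ^+ 2)) := normc_blaschke (s01 i) l1.
rewrite normcE2 expr1n; case: (blaschke _ _) => a b /= ab.
by apply: complex_eq => /=; rewrite -?ab; ring.
Qed.

Lemma blaschke_mx_mul (l : C) (z : 'cV[C]_n) : blaschke_mx l *m z =
  \sum_j blaschke (s j) l *: ((V *m z) j 0 *: col j U).
Proof.
apply/matrixP => i k; rewrite (ord1 k) summxE.
rewrite /blaschke_mx -!mulmxA mxE; apply: eq_bigr => j _.
by rewrite mul_diag_mx !mxE; ring.
Qed.

Lemma cderiv_blaschke_mx (g : 'cV[C]_n -> C) (z : 'cV[C]_n) (c l : C) :
  holomorphic (K := C) g -> normc l <= 1 ->
  exists d, cderiv_at (fun l => g (blaschke_mx l *m z) * c) l d.
Proof.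
move=> hg l1.
have dg := @derivable_along_curve C n g (fun j => blaschke (s j))
  (fun j => (V *m z) j 0 *: col j U) l hg.
have {}dg := dg (fun j => derivable_blaschke_factor (s01 j) l1).
have [d hd] := cderiv_of_derivable dg.
exists (d * c) => e e0.
have c0 : 0 < 1 + normc c by rewrite ltr_pwDl// normc_ge0.
have [r r0 H] := hd (e / (1 + normc c)) (divr_gt0 e0 c0).
exists r => // k kr; have := H k kr; rewrite -!blaschke_mx_mul => h.
have alg (x y : C) : x * c - y * c - d * c * k = (x - y - d * k) * c by ring.
rewrite alg.
rewrite Normc.normcM; apply: (@le_trans _ _ (e / (1 + normc c) * normc k * (1 + normc c))).
  by apply: ler_pM => //; rewrite ?normc_ge0// lerDr.
rewrite le_eqVlt; apply/orP; left; apply/eqP; field; exact: lt0r_neq0.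
Qed.

End matrix.

Lemma blaschke_mx_trC n (U V : 'M[C]_n) (s : 'I_n -> R) l :
  (blaschke_mx U V s l) ^t* = blaschke_mx (V ^t*) (U ^t*) s l^*.
Proof.
rewrite /blaschke_mx !trmx_mul !map_mxM tr_diag_mx map_diag_mx mulmxA.
have -> : map_mx Num.conj (\row_j blaschke (s j) l) = \row_j blaschke (s j) l^*.
  by apply/rowP => j; rewrite !mxE; exact: blaschkeJ.
by [].
Qed.

Lemma cmeasurable_circle b : cmeasurable (circle b : measurableTypeR R -> C).
Proof.
have h : cmeasurable (cexp 0 : measurableTypeR R -> C).
  split; (apply: measurable_funM; first exact: measurable_cst).
    by apply: continuous_measurable_fun; exact: continuous_cos.
  by apply: continuous_measurable_fun; exact: continuous_sin.
by case: b => //; exact: cmeasurableJ.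
Qed.

Lemma cmeasurable_blaschke b (s : R) : 0 <= s <= 1 ->
  cmeasurable (fun t : measurableTypeR R => blaschke s (circle b t)).
Proof.
move=> s01; rewrite /blaschke; case: eqP => [_|/eqP sn1]; first exact: cmeasurable_cst.
have mc := cmeasurable_circle b.
have mden : cmeasurable (fun t : measurableTypeR R => 1 + s%:C%C * circle b t).
  by apply: cmeasurableD; [exact: cmeasurable_cst|
    apply: cmeasurableM => //; exact: cmeasurable_cst].
pose D t := normc (1 + s%:C%C * circle b t) ^+ 2.
have D0 t : 0 < D t.
  have d0 : 1 + s%:C%C * circle b t != 0.
    by apply: blaschke_den_neq0 => //; rewrite normc_circle.
  rewrite exprn_gt0// lt_neqAle normc_ge0 andbT eq_sym.
  by apply: contra d0 => /eqP/Normc.eq0_normc ->.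
(* 1 / w = w^* / |w|^2, and the inverse of a positive D is exp (- ln D) *)
have -> : (fun t => (s%:C%C + circle b t) / (1 + s%:C%C * circle b t)) =
    fun t => (s%:C%C + circle b t) * ((1 + s%:C%C * circle b t)^* *
      (expR (- ln (D t)))%:C%C).
  apply/funext => t; congr (_ * _).
  rewrite expRN lnK ?posrE// /D; move: (D0 t); rewrite /D normcE2.
  case: (1 + _) => x y /= d0; apply: complex_eq => /=; field; exact: lt0r_neq0.
apply: cmeasurableM; first by apply: cmeasurableD => //; exact: cmeasurable_cst.
apply: cmeasurableM; first exact: cmeasurableJ.
split; last exact: measurable_cst.
apply: measurableT_comp; first exact: measurable_expR.
apply: measurable_funN; apply: (measurableT_comp (@measurable_ln R)).
by apply: measurable_funX; exact: cmeasurable_normc.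
Qed.

End blaschke.
(** * Averages of integrals *)
Section fubini_interval.
Context {R : realType} d (T : measurableType d).
Variable m : {sigma_finite_measure set T -> \bar R}.

(** The uniform bound K on the inner norms makes G integrable on the product,
    because the segment has finite length. *)
Lemma Rintegral_itv_int_swap (G : R -> T -> R) (c K : R) : 0 <= c ->
  measurable_fun setT (fun p : measurableTypeR R * T => G p.1 p.2) ->
  (forall th, (\int[m]_t `|G th t|%:E <= K%:E)%E) ->
  (forall t, integrable_on 0 c (G ^~ t)) ->
  \int[m]_t (itv_int 0 c (G ^~ t)) = itv_int 0 c (fun th => \int[m]_t (G th t)).
Proof.
move=> c0 mG GK Gi.
have mGth (th : R) : measurable_fun setT (G th).
  exact: (measurableT_comp mG (measurable_pair1 (th : measurableTypeR R))).
have K0 : 0 <= K.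
  rewrite -lee_fin; apply: le_trans (GK 0); apply: integral_ge0 => t _.
  by rewrite lee_fin.
have Gint th : m.-integrable setT (EFin \o G th).
  apply/integrableP; split; first exact/measurable_EFinP.
  exact: le_lt_trans (GK th) (ltry _).
pose F (p : measurableTypeR R * T) : \bar R := (\1_(`[0, c]%classic) p.1 * G p.1 p.2)%:E.
have mF : measurable_fun setT F.
  apply/measurable_EFinP; apply: measurable_funM => //.
  by apply: (measurableT_comp _ measurable_fst); exact: measurable_indic.
have Fint : ((@lebesgue_measure R) \x m)%E.-integrable setT F.
  apply/(integrable12ltyP _ _ mF).
  pose H : measurableTypeR R -> \bar R := cst K%:E \_ (`[0, c]%classic).
  have HI : (\int[@lebesgue_measure R]_th H th < +oo)%E.
    rewrite /H -integral_mkcond integral_cst//.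
    by rewrite [X in (_ * X)%E]lebesgue_measure_itv/=; case: ifP => _;
      rewrite ?mule0 ?ltry// -EFinN -EFinD -EFinM ltry.
  apply: le_lt_trans HI.
  apply: ge0_le_integral => //.
  - by move=> th _; apply: integral_ge0 => t _.
  - apply: (measurable_fun_fubini_tonelli_F (abse \o F)) => //=.
    exact: measurableT_comp.
  - apply/(measurable_restrictT _ _).1 => //; exact: measurable_cst.
  move=> th _; rewrite /H /patch; case: ifPn => thI.
    apply: le_trans (GK th); rewrite le_eqVlt; apply/orP; left; apply/eqP.
    by apply: eq_integral => t _; rewrite /F /= indicE thI mul1r.
  rewrite (eq_integral (fun=> 0%E)) ?integral0// => t _.
  by rewrite /F /= indicE (negPf thI) mul0r normr0.
have EL t : (itv_int 0 c (G ^~ t))%:E = (\int[@lebesgue_measure R]_th F (th, t))%E.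
  rewrite /itv_int /Rintegral fineK; last first.
    by apply: integrable_fin_num => //; exact: (Gi t).
  rewrite integral_mkcond; apply: eq_integral => th _.
  by rewrite /patch /F /= indicE; case: ifP => _; rewrite ?mul1r ?mul0r.
have ER : (\int[@lebesgue_measure R]_(th in `[0%R, c]) (\int[m]_t (G th t))%:E =
    \int[@lebesgue_measure R]_th \int[m]_t F (th, t))%E.
  rewrite integral_mkcond; apply: eq_integral => th _.
  rewrite /patch; case: ifPn => thI.
    rewrite /Rintegral fineK; last first.
      by apply: integrable_fin_num => //; exact: (Gint th).
    by apply: eq_integral => t _; rewrite /F /= indicE thI mul1r.
  rewrite (eq_integral (fun=> 0%E)) ?integral0// => t _.
  by rewrite /F /= indicE (negPf thI) mul0r.
rewrite [RHS]/itv_int /Rintegral; congr fine.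
apply: etrans (esym ER); apply: etrans (esym (Fubini Fint)).
by apply: eq_integral => t _; exact: EL.
Qed.

End fubini_interval.

(** * Weighted square-integrable functions *)
Section weighted_L2.
Context {R : realType} d (T : measurableType d).
Variables (m : {measure set T -> \bar R}) (rho : T -> R).
Hypotheses (mrho : measurable_fun setT rho) (rho0 : forall t, 0 <= rho t).
Local Notation C := (R[i]).
Local Notation normc := (@Normc.normc R).

Definition sqint (a : T -> C) : \bar R := (\int[m]_t (normc (a t) ^+ 2 * rho t)%:E)%E.

Definition weighted_product (a b : T -> C) (t : T) : C :=
  a t * (b t)^* * (rho t)%:C%C.

Lemma cmeasurable_weighted_product a b : cmeasurable a -> cmeasurable b ->
  cmeasurable (weighted_product a b).
Proof.
move=> ma mb; apply: cmeasurableM; last by split => //; exact: measurable_cst.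
by apply: cmeasurableM => //; exact: cmeasurableJ.
Qed.

Lemma measurable_sqint a : cmeasurable a ->
  measurable_fun setT (fun t => (normc (a t) ^+ 2 * rho t)%:E).
Proof.
move=> ma; apply/measurable_EFinP; apply: measurable_funM => //.
by apply: measurable_funX; exact: cmeasurable_normc.
Qed.

(** 2 |a b| <= |a|^2 + |b|^2 replaces the Cauchy-Schwarz inequality. *)
Lemma weighted_product_bound a b t : normc (weighted_product a b t) <=
  normc (a t) ^+ 2 * rho t + normc (b t) ^+ 2 * rho t.
Proof.
rewrite !Normc.normcM normc_conj normc_real ger0_norm// -mulrDl ler_wpM2r//.
have := sqr_ge0 (normc (a t) - normc (b t)); rewrite sqrrB.
have := sqr_ge0 (normc (a t)); have := sqr_ge0 (normc (b t)).
move: (normc (a t)) (normc (b t)) => x y; lra.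
Qed.

Lemma weighted_product_integral_le a b (F : T -> R) : cmeasurable a -> cmeasurable b ->
  measurable_fun setT F ->
  (forall t, `|F t| <= normc (weighted_product a b t)) ->
  (\int[m]_t `|F t|%:E <= sqint a + sqint b)%E.
Proof.
move=> ma mb mF Fle; rewrite /sqint -ge0_integralD//; last 4 first.
- by move=> t _; rewrite lee_fin mulr_ge0// sqr_ge0.
- exact: measurable_sqint.
- by move=> t _; rewrite lee_fin mulr_ge0// sqr_ge0.
- exact: measurable_sqint.
apply: ge0_le_integral => //.
- by apply/measurable_EFinP; exact: measurableT_comp.
- by apply: emeasurable_funD; exact: measurable_sqint.
by move=> t _; rewrite -EFinD lee_fin; exact: le_trans (Fle t) (weighted_product_bound _ _ _).
Qed.

Lemma weighted_product_integrable a b : cmeasurable a -> cmeasurable b ->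
  (sqint a < +oo)%E -> (sqint b < +oo)%E ->
  m.-integrable setT (EFin \o (@complex.Re R \o weighted_product a b)) /\
  m.-integrable setT (EFin \o (@complex.Im R \o weighted_product a b)).
Proof.
move=> ma mb ia ib; have [mR mI] := cmeasurable_weighted_product ma mb.
have ab : (sqint a + sqint b < +oo)%E by rewrite lte_add_pinfty.
split; apply/integrableP; split; try exact/measurable_EFinP.
  apply: le_lt_trans ab; apply: (weighted_product_integral_le ma mb mR) => t.
  exact: normc_Re.
apply: le_lt_trans ab; apply: (weighted_product_integral_le ma mb mI) => t.
exact: normc_Im.
Qed.

End weighted_L2.

(** * Composition with contractions on the Fock space *)

Lemma trmxC_mul3 (K : numClosedFieldType) n (A B D : 'M[K]_n) :
  (A *m B *m D) ^t* = D ^t* *m B ^t* *m A ^t*.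
Proof. by rewrite trmx_mul map_mxM trmx_mul map_mxM mulmxA. Qed.

Section fock_space_lemmas.
Context {R : realType} {n : nat} (psi : R -> R).
Hypothesis cpsi : {within `[0, +oo[, continuous psi}.
Local Notation C := (R[i]).
Local Notation Cn := ('cV[C]_n).
Local Notation normc := (@Normc.normc R).
Local Notation X := ((n + n).-tuple (measurableTypeR R)).
Local Notation m := (lebesgue_Cn R n).
Implicit Types f g : Cn -> C.

Let rho (t : X) : R := density psi (to_Cn t).

Let rho_ge0 t : 0 <= rho t. Proof. exact: expR_ge0. Qed.

Lemma measurable_density d (T : measurableType d) (Phi : T -> Cn) :
  (forall i, cmeasurable (fun t => Phi t i 0)) ->
  measurable_fun setT (fun t => density psi (Phi t)).
Proof.
move=> mPhi; apply: (measurableT_comp (@measurable_expR R)).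
apply: measurable_funN.
have mpsi : measurable_fun (`[0, +oo[%classic : set R) psi.
  by apply: subspace_continuous_measurable_fun.
apply: (measurable_comp _ _ mpsi (measurable_sqnorm mPhi)) => //.
by move=> _ [t _ <-] /=; rewrite in_itv/= andbT sqnorm_ge0.
Qed.

Let mrho : measurable_fun setT rho.
Proof. by apply: measurable_density => i; exact: cmeasurable_to_Cn. Qed.

Lemma holomorphic_cmeasurable g d (T : measurableType d) (Phi : T -> Cn) :
  holomorphic (K := C) g -> (forall i, cmeasurable (fun t => Phi t i 0)) ->
  cmeasurable (fun t => g (Phi t)).
Proof.
move=> hg; apply: cmeasurable_continuous_comp => z e e0.
have cg : {for z, continuous (g : 'cV[(C : numFieldType)]_n -> (C : numFieldType))}.
  exact: differentiable_continuous (hg z).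
have e0' : (0 : C) < e%:C%C by rewrite ltcR.
have [r r0 H] := continuous_cV_estimate cg e0'.
move: r0; rewrite ltcE => /andP[/eqP /= ri r0].
exists (complex.Re r) => // w wz; rewrite -lecR; apply: H => i.
rewrite normC_normc (_ : r = (complex.Re r)%:C%C); first by rewrite ltcR.
by apply: complex_eq.
Qed.

Lemma fock_cmeasurable g (A : 'M[C]_n) : holomorphic (K := C) g ->
  cmeasurable (fun t : X => g (A *m to_Cn t)).
Proof.
move=> hg; apply: holomorphic_cmeasurable => // i.
apply: cmeasurable_mulmx => [j k|j]; first exact: cmeasurable_cst.
exact: cmeasurable_to_Cn.
Qed.

Lemma fock_cmeasurable1 g : holomorphic (K := C) g ->
  cmeasurable (fun t : X => g (to_Cn t)).
Proof.
by move=> hg; apply: holomorphic_cmeasurable => // i; exact: cmeasurable_to_Cn.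
Qed.

Local Notation wprod f g := (weighted_product rho (fun t : X => f (to_Cn t)) (fun t : X => g (to_Cn t))).

Lemma Re_fock_dot f g :
  complex.Re (fock_dot psi f g) = \int[m]_t complex.Re (wprod f g t).
Proof. by []. Qed.

Lemma Im_fock_dot f g :
  complex.Im (fock_dot psi f g) = \int[m]_t complex.Im (wprod f g t).
Proof. by []. Qed.

Lemma fock_sqint f : fock psi f -> (sqint m rho (fun t : X => f (to_Cn t)) < +oo)%E.
Proof. by case. Qed.

Lemma fock_integrable f g : fock psi f -> fock psi g ->
  m.-integrable setT (EFin \o (@complex.Re R \o wprod f g)) /\
  m.-integrable setT (EFin \o (@complex.Im R \o wprod f g)).
Proof.
move=> ff fg; apply: weighted_product_integrable => //.
- exact: fock_cmeasurable1 ff.1.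
- exact: fock_cmeasurable1 fg.1.
- exact: fock_sqint.
- exact: fock_sqint.
Qed.

Lemma density_unitary (U : 'M[C]_n) (z : Cn) : U \is unitarymx ->
  density psi (U *m z) = density psi z.
Proof. by move=> Uu; rewrite /density sqnorm_unitary. Qed.

Lemma sqint_unitary (U : 'M[C]_n) f : U \is unitarymx -> holomorphic (K := C) f ->
  sqint m rho (fun t : X => f (U *m to_Cn t)) = sqint m rho (fun t : X => f (to_Cn t)).
Proof.
move=> Uu hf; rewrite /sqint.
apply: etrans (ge0_integral_preserves (unitary_preserves Uu)
  (measurable_sqint mrho (fock_cmeasurable1 hf)) _); last first.
  by move=> t; rewrite lee_fin mulr_ge0// sqr_ge0.
apply: eq_integral => t _; congr (_%:E).
by rewrite /rho (to_Cn_act U t) density_unitary.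
Qed.

(** The substitution of U z for z, which preserves Lebesgue measure and the
    weight. *)
Lemma fock_dot_unitary (U : 'M[C]_n) f g : U \is unitarymx ->
  holomorphic (K := C) f -> holomorphic (K := C) g ->
  fock_dot psi (fun z => f (U *m z)) g = fock_dot psi f (fun z => g (U ^t* *m z)).
Proof.
move=> Uu hf hg.
have UU (z : Cn) : U ^t* *m (U *m z) = z.
  by have /unitarymxP/mulmx1C UU := Uu; rewrite mulmxA UU mul1mx.
have [mR mI] := cmeasurable_weighted_product mrho (fock_cmeasurable1 hf)
  (fock_cmeasurable (U ^t*) hg).
have E (t : X) : weighted_product rho (fun t : X => f (to_Cn t))
     (fun t : X => g (U ^t* *m to_Cn t)) (act U t) =
   weighted_product rho (fun t : X => f (U *m to_Cn t)) (fun t : X => g (to_Cn t)) t.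
  by rewrite /weighted_product /rho (to_Cn_act U t) density_unitary// UU.
have mR' := (measurable_EFinP _ _).2 mR; have mI' := (measurable_EFinP _ _).2 mI.
apply: complex_eq; rewrite ?Re_fock_dot ?Im_fock_dot /Rintegral; congr fine.
  apply: etrans _ (integral_preserves (unitary_preserves Uu) mR').
  by apply: eq_integral => t _ /=; rewrite E.
apply: etrans _ (integral_preserves (unitary_preserves Uu) mI').
by apply: eq_integral => t _ /=; rewrite E.
Qed.

Lemma Re_fock_dotC f g : complex.Re (fock_dot psi f g) = complex.Re (fock_dot psi g f).
Proof.
rewrite !Re_fock_dot; apply: eq_Rintegral => t _ /=.
rewrite /weighted_product; case: (f _) => a b; case: (g _) => c d /=; ring.
Qed.

Lemma Im_fock_dot_Re f g :
  complex.Im (fock_dot psi f g) = complex.Re (fock_dot psi (fun z => (Complex 0 (-1)) * f z) g).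
Proof.
rewrite Re_fock_dot Im_fock_dot; apply: eq_Rintegral => t _ /=.
rewrite /weighted_product -2![Complex 0 (-1) * _ * _]mulrA cReM /=; ring.
Qed.

Lemma holomorphic_scale (c : C) f : holomorphic (K := C) f ->
  holomorphic (K := C) (fun z => c * f z).
Proof.
move=> hf z.
exact: (@differentiableZ C _ _ (f : 'cV[(C : numFieldType)]_n -> (C : numFieldType)) c z (hf z)).
Qed.

Lemma fock_scale (c : C) f : fock psi f -> fock psi (fun z => c * f z).
Proof.
move=> ff; split; first exact: holomorphic_scale ff.1.
have E (t : X) : (normc (c * f (to_Cn t)) ^+ 2 * density psi (to_Cn t))%:E =
    ((normc c ^+ 2)%:E * (normc (f (to_Cn t)) ^+ 2 * rho t)%:E)%E.
  by rewrite Normc.normcM -EFinM; congr (_%:E); rewrite /rho; ring.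
rewrite (eq_integral _ _ (fun t _ => E t)) ge0_integralZl//.
- by rewrite lte_mul_pinfty ?lee_fin ?sqr_ge0//; exact: fock_sqint.
- by apply: (measurable_sqint mrho); exact: fock_cmeasurable1 ff.1.
- by move=> t _; rewrite lee_fin mulr_ge0// sqr_ge0.
- by rewrite lee_fin sqr_ge0.
Qed.

Section circle.
Variables (U V : 'M[C]_n) (s : 'I_n -> R).
Hypotheses (Uu : U \is unitarymx) (Vu : V \is unitarymx).
Hypothesis s01 : forall j, 0 <= s j <= 1.

(** The mean value property of l |-> f (M(l) z) * conj (g z) * rho z for each z,
    integrated over z.  For |l| = 1 the matrix M(l) is unitary, so
    |f (M(l) z)|^2 has the same weighted integral as |f|^2: this is the uniform
    bound that Fubini's theorem asks for.  Only real parts are compared; f may be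
    multiplied by -i to get the imaginary ones. *)
Lemma fock_dot_circle (A : 'M[C]_n) b f g :
  A = U *m diag_mx (\row_j (s j)%:C%C) *m V -> fock psi f -> fock psi g ->
  fock psi (fun z => f (A *m z)) ->
  itv_int 0 (2 * pi) (fun th => complex.Re
    (fock_dot psi (fun z => f (blaschke_mx U V s (circle b th) *m z)) g)) =
  2 * pi * complex.Re (fock_dot psi (fun z => f (A *m z)) g).
Proof.
move=> AE ff fg fA.
pose Mx th := blaschke_mx U V s (circle b th).
have Mxu th : Mx th \is unitarymx by apply: blaschke_mx_unitary => //; exact: normc_circle.
pose G (th : R) (t : X) : R := complex.Re (weighted_product rho
  (fun t : X => f (Mx th *m to_Cn t)) (fun t : X => g (to_Cn t)) t).
have mean t := circle_mean b (fun l => @cderiv_blaschke_mx R n U V s s01 f (to_Cn t)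
  ((g (to_Cn t))^* * (rho t)%:C%C) l ff.1).
have pi2 : 0 <= 2 * pi :> R by rewrite mulr_ge0// pi_ge0.
have GE t : G ^~ t = fun th => complex.Re (f (blaschke_mx U V s (circle b th) *m to_Cn t) *
    ((g (to_Cn t))^* * (rho t)%:C%C)).
  by apply/funext => th; rewrite /G /weighted_product mulrA.
have mMx i j : cmeasurable (fun p : measurableTypeR R * X => Mx p.1 i j).
  rewrite (_ : (fun p => _) = fun p : measurableTypeR R * X =>
      \sum_k U i k * blaschke (s k) (circle b p.1) * V k j); last first.
    apply/funext => p; rewrite /Mx /blaschke_mx mxE; apply: eq_bigr => k _.
    by rewrite mul_mx_diag !mxE.
  apply: cmeasurable_sum => k; apply: cmeasurableM; last exact: cmeasurable_cst.
  apply: cmeasurableM; first exact: cmeasurable_cst.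
  exact: (cmeasurable_comp (cmeasurable_blaschke b (s01 k)) measurable_fst).
have msnd i : cmeasurable (fun p : measurableTypeR R * X => to_Cn p.2 i 0).
  exact: (cmeasurable_comp (cmeasurable_to_Cn i) measurable_snd).
have mG : measurable_fun setT (fun p : measurableTypeR R * X => G p.1 p.2).
  have [] : cmeasurable (fun p : measurableTypeR R * X =>
      f (Mx p.1 *m to_Cn p.2) * (g (to_Cn p.2))^* * (rho p.2)%:C%C); last by [].
  apply: cmeasurableM; last first.
    by split; [exact: (measurableT_comp mrho measurable_snd)|exact: measurable_cst].
  apply: cmeasurableM; last by apply: cmeasurableJ; exact: holomorphic_cmeasurable fg.1 msnd.
  by apply: holomorphic_cmeasurable ff.1 _; exact: cmeasurable_mulmx.
have Ifin : (sqint m rho (fun t : X => f (to_Cn t)) +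
    sqint m rho (fun t : X => g (to_Cn t)))%E \is a fin_num.
  have pos a : (0 <= sqint m rho a)%E.
    by apply: integral_ge0 => t _; rewrite lee_fin mulr_ge0// sqr_ge0.
  rewrite ge0_fin_numE; last by apply: adde_ge0; exact: pos.
  by apply: lte_add_pinfty; exact: fock_sqint.
pose K := fine (sqint m rho (fun t : X => f (to_Cn t)) +
  sqint m rho (fun t : X => g (to_Cn t)))%E.
rewrite [in RHS]Re_fock_dot.
apply: etrans _ (RintegralZl (2 * pi) measurableT (fock_integrable fA fg).1).
apply: etrans (esym (@Rintegral_itv_int_swap R _ X m G (2 * pi) K pi2 mG _ _)) _.
- move=> th; rewrite (fineK Ifin) -(sqint_unitary (Mxu th) ff.1).
  apply: weighted_product_integral_le => //.
  + exact: fock_cmeasurable ff.1.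
  + exact: fock_cmeasurable1 fg.1.
  + exact: (measurableT_comp mG (measurable_pair1 (th : measurableTypeR R))).
  + by move=> t; exact: normc_Re.
- by move=> t; rewrite GE; exact: (mean t).1.
apply: eq_Rintegral => t _; rewrite GE; apply: etrans (mean t).2 _.
by rewrite blaschke_mx0 -AE /weighted_product mulrA.
Qed.

End circle.

(** Both sides are averages over the circle, and the integrands agree pointwise by
    [fock_dot_unitary], the circle being run through backwards on the right. *)
Lemma fock_dot_adjoint_matrix (A : 'M[C]_n) f g : opnorm A <= 1 ->
  (forall h, fock psi h -> fock psi (fun z => h (A *m z))) ->
  (forall h, fock psi h -> fock psi (fun z => h (A ^t* *m z))) ->
  fock psi f -> fock psi g ->
  fock_dot psi (fun z => f (A *m z)) g = fock_dot psi f (fun z => g (A ^t* *m z)).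
Proof.
move=> A1 bA bA' ff fg.
have [U [V [s [Uu Vu s01 AE]]]] :=
  singular_value_decomposition (fun w => @opnorm_le1 R n A w A1).
have AE' : A ^t* = (V ^t*) *m diag_mx (\row_j (s j)%:C%C) *m (U ^t*).
  by rewrite AE trmxC_mul3 rdiag_trC.
have V'u : V ^t* \is unitarymx by rewrite trmxC_unitary; exact: Vu.
have U'u : U ^t* \is unitarymx by rewrite trmxC_unitary; exact: Uu.
have ReE f' : fock psi f' -> complex.Re (fock_dot psi (fun z => f' (A *m z)) g) =
    complex.Re (fock_dot psi f' (fun z => g (A ^t* *m z))).
  move=> ff'.
  have pi2 : 2 * pi != 0 :> R by rewrite mulf_neq0// gt_eqF// pi_gt0.
  apply: (mulfI pi2).
  have e1 := fock_dot_circle Uu Vu s01 false AE ff' fg (bA _ ff').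
  have e2 := fock_dot_circle V'u U'u s01 true AE' fg ff' (bA' _ fg).
  apply: (etrans (esym e1)); apply: (etrans _ (etrans e2 _)); last first.
    by congr (_ * _); exact: Re_fock_dotC.
  congr itv_int; apply/funext => th.
  have Mu : blaschke_mx U V s (circle false th) \is unitarymx.
    by apply: blaschke_mx_unitary => //; exact: normc_circle.
  apply: (etrans (congr1 _ (fock_dot_unitary Mu ff'.1 fg.1))).
  by apply: (etrans (Re_fock_dotC _ _)); rewrite blaschke_mx_trC.
apply: complex_eq; first exact: ReE.
by rewrite !Im_fock_dot_Re; apply: ReE; exact: fock_scale.
Qed.

End fock_space_lemmas.
(** * Inner products of constants and coordinates *)
Section fock_moments.
Context {R : realType} {n : nat} (psi : R -> R).
Hypothesis cpsi : {within `[0, +oo[, continuous psi}.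
Local Notation C := (R[i]).
Local Notation Cn := ('cV[C]_n).
Local Notation normc := (@Normc.normc R).
Local Notation X := ((n + n).-tuple (measurableTypeR R)).
Local Notation m := (lebesgue_Cn R n).
Implicit Types f g : Cn -> C.

Let rho (t : X) : R := density psi (to_Cn t).

Let rho_ge0 t : 0 <= rho t. Proof. exact: expR_ge0. Qed.

Let mrho : measurable_fun setT rho.
Proof. by apply: measurable_density => // i; exact: cmeasurable_to_Cn. Qed.

Lemma fockD f g : fock psi f -> fock psi g -> fock psi (fun z => f z + g z).
Proof.
move=> ff fg; have hfg : holomorphic (K := C) (fun z => f z + g z).
  move=> z; exact: (@differentiableD C _ _ (f : 'cV[(C : numFieldType)]_n -> (C : numFieldType)) g z (ff.1 z) (fg.1 z)).
split=> //.
have mf := measurable_sqint mrho (fock_cmeasurable1 ff.1).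
have mg := measurable_sqint mrho (fock_cmeasurable1 fg.1).
have pos f' (t : X) : (0 <= (normc (f' (to_Cn t)) ^+ 2 * rho t)%:E)%E.
  by rewrite lee_fin mulr_ge0// sqr_ge0.
apply: (@le_lt_trans _ _ (2%:E * (sqint m rho (fun t : X => f (to_Cn t)) +
    sqint m rho (fun t : X => g (to_Cn t))))%E); last first.
  apply: lte_mul_pinfty => //; apply: lte_add_pinfty.
    exact: fock_sqint ff.
  exact: fock_sqint fg.
rewrite /sqint -ge0_integralD// -ge0_integralZl//; last 2 first.
- exact: emeasurable_funD.
- by move=> t _; apply: adde_ge0; exact: pos.
apply: ge0_le_integral => //.
- by move=> t _; exact: (pos (fun z => f z + g z)).
- exact: (measurable_sqint mrho (fock_cmeasurable1 hfg)).
- by apply: emeasurable_funM => //; exact: emeasurable_funD.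
move=> t _; rewrite -EFinD -EFinM lee_fin -/(rho t) -mulrDl mulrA ler_wpM2r//.
have a0 := normc_ge0 (f (to_Cn t)); have b0 := normc_ge0 (g (to_Cn t)).
apply: (@le_trans _ _ ((normc (f (to_Cn t)) + normc (g (to_Cn t))) ^+ 2)).
  by rewrite ler_pXn2r ?nnegrE ?normc_ge0 ?addr_ge0//; exact: le_normcD.
move: (normc _) (normc _) => x y; have := sqr_ge0 (x - y); rewrite sqrrB sqrrD; lra.
Qed.

Lemma fock_dotD f1 f2 g : fock psi f1 -> fock psi f2 -> fock psi g ->
  fock_dot psi (fun z => f1 z + f2 z) g = fock_dot psi f1 g + fock_dot psi f2 g.
Proof.
move=> ff1 ff2 fg.
have [r1 i1] := fock_integrable cpsi ff1 fg.
have [r2 i2] := fock_integrable cpsi ff2 fg.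
apply: complex_eq.
  rewrite cReD !Re_fock_dot -(RintegralD measurableT r1 r2).
  by apply: eq_Rintegral => t _; rewrite /weighted_product !mulrDl cReD.
rewrite cImD !Im_fock_dot -(RintegralD measurableT i1 i2).
by apply: eq_Rintegral => t _; rewrite /weighted_product !mulrDl cImD.
Qed.

Lemma fock_dotZ (c : C) f g : fock psi f -> fock psi g ->
  fock_dot psi (fun z => c * f z) g = c * fock_dot psi f g.
Proof.
move=> ff fg; have [r i] := fock_integrable cpsi ff fg.
have rZ (k : R) := integrableZl measurableT k r.
have iZ (k : R) := integrableZl measurableT k i.
apply: complex_eq.
  rewrite cReM !(Re_fock_dot, Im_fock_dot) -(RintegralZl _ measurableT r).
  rewrite -(RintegralZl _ measurableT i) -(RintegralB measurableT (rZ _) (iZ _)).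
  by apply: eq_Rintegral => t _; rewrite /weighted_product -!(mulrA c) cReM.
rewrite cImM !(Re_fock_dot, Im_fock_dot) -(RintegralZl _ measurableT i).
rewrite -(RintegralZl _ measurableT r) -(RintegralD measurableT (iZ _) (rZ _)).
by apply: eq_Rintegral => t _; rewrite /weighted_product -!(mulrA c) cImM.
Qed.

Lemma fock_dotJ f g : fock psi f -> fock psi g ->
  (fock_dot psi f g)^* = fock_dot psi g f.
Proof.
move=> ff fg; have [_ i] := fock_integrable cpsi ff fg.
apply: complex_eq; first by rewrite cReJ Re_fock_dotC.
rewrite cImJ !Im_fock_dot -mulN1r -(RintegralZl _ measurableT i).
apply: eq_Rintegral => t _; rewrite /weighted_product /=.
by case: (f _) => a b; case: (g _) => c d /=; ring.
Qed.

Lemma fock_dot_gt0 f (B : set X) : fock psi f -> measurable B ->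
  (0 < m B)%E -> (forall t, B t -> f (to_Cn t) != 0) ->
  0 < complex.Re (fock_dot psi f f).
Proof.
move=> ff mB B0 fB; have [r _] := fock_integrable cpsi ff ff.
have E t : complex.Re (weighted_product rho (fun t : X => f (to_Cn t))
    (fun t : X => f (to_Cn t)) t) = normc (f (to_Cn t)) ^+ 2 * rho t.
  by rewrite /weighted_product normcE2; case: (f _) => a b /=; ring.
rewrite Re_fock_dot lt_neqAle; apply/andP; split; last first.
  by apply: Rintegral_ge0 => t _; rewrite E mulr_ge0// sqr_ge0.
apply/negP => /eqP h0.
pose F (t : X) := (normc (f (to_Cn t)) ^+ 2 * rho t)%:E.
have mF : measurable_fun setT F by exact: (measurable_sqint mrho (fock_cmeasurable1 ff.1)).
have I0 : (\int[m]_t `|F t|)%E = 0%E.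
  transitivity (\int[m]_t (complex.Re (weighted_product rho (fun t : X => f (to_Cn t))
      (fun t : X => f (to_Cn t)) t))%:E)%E.
    apply: eq_integral => t _; rewrite E gee0_abs// lee_fin.
    by rewrite mulr_ge0// sqr_ge0.
  by rewrite -[LHS]fineK; [rewrite -[fine _]h0|exact: integrable_fin_num r].
have [A [mA A0 AF]] := (ae_eq_integral_abs m measurableT mF).1 I0.
have BA : B `<=` A.
  move=> t Bt; apply: AF => /= /(_ I) [] /eqP.
  rewrite mulf_eq0 sqrf_eq0 => /orP[/eqP/Normc.eq0_normc h|].
    by have := fB t Bt; rewrite h eqxx.
  by rewrite gt_eqF// expR_gt0.
have : (m B <= 0)%E by rewrite -A0; exact: (le_measure m (mem_set mB) (mem_set mA) BA).
by rewrite leNgt B0.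
Qed.

Lemma holomorphic_cst (c : C) : holomorphic (K := C) (fun _ : Cn => c).
Proof. by move=> z; exact: differentiable_cst. Qed.

Lemma holomorphic_coord (j : 'I_n) : holomorphic (K := C) (fun z : Cn => z j 0).
Proof. by move=> z; exact: differentiable_coord. Qed.

Hypothesis growth : exists2 a : R, 0 < a & forall y, 0 <= y -> a * y <= psi y.

(** With y = |z|^2, the integrand is at most
    (1 + y) exp (- a y) <= (1 + 2 / a) exp (- a y / 2), a Gaussian. *)
Lemma fock_of_linear_growth f : holomorphic (K := C) f ->
  (forall z, normc (f z) ^+ 2 <= 1 + sqnorm z) -> fock psi f.
Proof.
move=> hf fz; split=> //; have [a a0 apsi] := growth.
have b0 : 0 < a / 2 by rewrite divr_gt0.
have K0 : 0 <= 1 + 2 / a by rewrite addr_ge0// divr_ge0// ltW.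
have mE : measurable_fun setT (fun t : X => (expR (- (a / 2 * \sum_i tnth t i ^+ 2)))%:E).
  apply/measurable_EFinP; apply: measurableT_comp => //; apply: measurable_funN.
  apply: measurable_funM => //; apply: measurable_sum => i.
  by apply: measurable_funX; exact: measurable_tnth.
have E0 (t : X) : (0 <= (expR (- (a / 2 * \sum_i tnth t i ^+ 2)))%:E)%E.
  by rewrite lee_fin expR_ge0.
apply: (@le_lt_trans _ _ ((1 + 2 / a)%:E *
    \int[m]_t (expR (- (a / 2 * \sum_i tnth t i ^+ 2)))%:E)%E); last first.
  by apply: lte_mul_pinfty; rewrite ?lee_fin//; exact: tuple_gaussian_integral_lty.
rewrite -ge0_integralZl//.
apply: ge0_le_integral => //.
- by move=> t _; rewrite lee_fin mulr_ge0 ?sqr_ge0// expR_ge0.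
- exact: (measurable_sqint mrho (fock_cmeasurable1 hf)).
- by apply: emeasurable_funM => //.
move=> t _; rewrite -EFinM lee_fin -sqnorm_to_Cn /density.
set y := sqnorm (to_Cn t); have y0 : 0 <= y by exact: sqnorm_ge0.
apply: (@le_trans _ _ ((1 + y) * expR (- (a * y)))).
  apply: ler_pM; rewrite ?sqr_ge0 ?expR_ge0 ?fz// ler_expR lerN2; exact: apsi.
have -> : expR (- (a * y)) = expR (- (a / 2 * y)) * expR (- (a / 2 * y)).
  by rewrite -expRD; congr expR; field.
rewrite mulrA ler_wpM2r ?expR_ge0// expRN ler_pdivrMr ?expR_gt0//.
apply: (@le_trans _ _ ((1 + 2 / a) * (1 + a / 2 * y))); last first.
  by rewrite ler_wpM2l//; exact: expR_ge1Dx.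
have -> : (1 + 2 / a) * (1 + a / 2 * y) = 1 + y + (2 / a + a / 2 * y) by field; rewrite gt_eqF.
have h1 : 0 <= 2 / a by rewrite divr_ge0// ltW.
have h2 : 0 <= a / 2 * y by rewrite mulr_ge0// ltW.
lra.
Qed.

Lemma fock1 : fock psi (fun _ : Cn => 1).
Proof.
apply: fock_of_linear_growth; first exact: holomorphic_cst.
move=> z; rewrite /= expr1n expr0n addr0 sqrtr1 expr1n lerDl; exact: sqnorm_ge0.
Qed.

Lemma fock_coord (j : 'I_n) : fock psi (fun z : Cn => z j 0).
Proof.
apply: fock_of_linear_growth; first exact: holomorphic_coord.
move=> z; rewrite sqnormE (bigD1 j)//= addrCA lerDl addr_ge0//.
by apply: sumr_ge0 => i _; exact: sqr_ge0.
Qed.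

Lemma fock_dot_affine (A : 'M[C]_n) (D : Cn) i g : fock psi g ->
  fock_dot psi (fun z => (A *m z + D) i 0) g =
  \sum_k A i k * fock_dot psi (fun z => z k 0) g +
  D i 0 * fock_dot psi (fun=> 1) g.
Proof.
move=> fg; pose S (r : seq 'I_n) (z : Cn) := \sum_(k <- r) A i k * z k 0.
have main r : fock psi (S r) /\
    fock_dot psi (S r) g = \sum_(k <- r) A i k * fock_dot psi (fun z => z k 0) g.
  elim: r => [|k r [IH1 IH2]].
    have -> : S [::] = fun z => 0 * 1.
      by apply/funext => z; rewrite /S big_nil mul0r.
    split; first exact: (fock_scale cpsi 0 fock1).
    by rewrite (fock_dotZ 0 fock1 fg) mul0r big_nil.
  have -> : S (k :: r) = fun z => A i k * z k 0 + S r z.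
    by apply/funext => z; rewrite /S big_cons.
  have fk := fock_scale cpsi (A i k) (fock_coord k).
  split; first exact: fockD fk IH1.
  by rewrite (fock_dotD fk IH1 fg) IH2 (fock_dotZ _ (fock_coord k) fg) big_cons.
have [fS ES] := main (index_enum 'I_n).
rewrite -ES -(fock_dotZ _ fock1 fg) -(fock_dotD fS (fock_scale cpsi _ fock1) fg).
congr (fock_dot psi _ g); apply/funext => z.
by rewrite /S !mxE mulr1.
Qed.

Lemma diag_sign_unitary (e : 'I_n -> bool) :
  diag_mx (\row_j (-1) ^+ e j) \is @unitarymx C n n.
Proof.
apply/unitarymxP; rewrite tr_diag_mx map_diag_mx mulmx_diag.
apply/matrixP => i j; rewrite !mxE; congr (_ *+ _).
by rewrite rmorphXn rmorphN1 -signr_addb addbb.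
Qed.

Lemma diag_sign_trC (e : 'I_n -> bool) :
  (diag_mx (\row_j (-1) ^+ e j) : 'M[C]_n) ^t* = diag_mx (\row_j (-1) ^+ e j).
Proof.
rewrite tr_diag_mx map_diag_mx; congr diag_mx; apply/rowP => j.
by rewrite !mxE rmorphXn rmorphN1.
Qed.

Lemma complex_eq_opp (x : C) : - x = x -> x = 0.
Proof. by case: x => a b [? ?]; apply: complex_eq => /=; lra. Qed.

(** Invariance under z |-> - z. *)
Lemma fock_dot_coord1 j : fock_dot psi (fun z : Cn => z j 0) (fun=> 1) = 0.
Proof.
apply: complex_eq_opp.
have := fock_dot_unitary cpsi (diag_sign_unitary (fun=> true)) (holomorphic_coord j)
  (holomorphic_cst 1).
rewrite (_ : (fun z => _) = fun z : Cn => -1 * z j 0); last first.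
  by apply/funext => z; rewrite mul_diag_mx !mxE expr1.
by rewrite (fock_dotZ _ (fock_coord j) fock1) mulN1r.
Qed.

(** Invariance under the change of sign of z_i alone. *)
Lemma fock_dot_coord_neq i j : i != j ->
  fock_dot psi (fun z : Cn => z i 0) (fun z => z j 0) = 0.
Proof.
move=> ij; apply: complex_eq_opp.
have := fock_dot_unitary cpsi (diag_sign_unitary (fun k => k == i)) (holomorphic_coord i)
  (holomorphic_coord j).
rewrite diag_sign_trC.
rewrite (_ : (fun z => _) = fun z : Cn => -1 * z i 0); last first.
  by apply/funext => z; rewrite mul_diag_mx !mxE eqxx expr1.
rewrite (fock_dotZ _ (fock_coord i) (fock_coord j)) mulN1r => ->; congr fock_dot.
by apply/funext => z; rewrite mul_diag_mx !mxE eq_sym (negPf ij) expr0 mul1r.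
Qed.

Lemma tperm_mx_trC (i j : 'I_n) : (tperm_mx i j : 'M[C]_n) ^t* = tperm_mx i j.
Proof.
rewrite tr_tperm_mx; apply/matrixP => k l; rewrite !mxE.
by case: (_ == _); rewrite ?rmorph1 ?rmorph0.
Qed.

(** Invariance under the exchange of z_i and z_j. *)
Lemma fock_dot_coord_eq i j :
  fock_dot psi (fun z : Cn => z i 0) (fun z => z i 0) =
  fock_dot psi (fun z : Cn => z j 0) (fun z => z j 0).
Proof.
have Pu : (tperm_mx i j : 'M[C]_n) \is unitarymx.
  by apply/unitarymxP; rewrite tperm_mx_trC -perm_mxM tperm2 perm_mx1.
have E k (z : Cn) : (tperm_mx i j *m z) k 0 = z (tperm i j k) 0.
  by rewrite -row_permE mxE.
have := fock_dot_unitary cpsi Pu (holomorphic_coord i) (holomorphic_coord j).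
rewrite tperm_mx_trC.
under eq_fun do rewrite E tpermL.
by under [X in _ = fock_dot psi _ X]eq_fun do rewrite E tpermR.
Qed.

Lemma fock_dot_coord_gt0 j :
  0 < complex.Re (fock_dot psi (fun z : Cn => z j 0) (fun z => z j 0)).
Proof.
(* a box of measure 1 on which no coordinate vanishes *)
pose B : set X := [set t | forall i, `[1, 2]%classic (tnth t i)].
apply: (@fock_dot_gt0 _ B) => //; first exact: fock_coord.
- exact: (measurable_box (fun=> measurable_itv _)).
- rewrite [X in (_ < X)%E](@tuple_measure_box _ _ R (@lebesgue_measure R) (n + n)
    (fun=> `[1, 2]%classic) (fun=> measurable_itv _)).
  rewrite (eq_bigr (fun=> 1%E)) ?big1_eq ?lte01// => i _.
  rewrite [LHS]lebesgue_measure_itv/= lte_fin ltr1n -EFinD; congr (_%:E); ring.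
- move=> t Bt; apply/eqP => h; have := Bt (lshift n j).
  have := congr1 (@complex.Re R) h; rewrite mxE /= => ->.
  by rewrite in_itv/= ler10.
Qed.

Lemma fock_dot1_gt0 : 0 < complex.Re (fock_dot psi (fun _ : Cn => 1) (fun=> 1)).
Proof.
apply: (@fock_dot_gt0 _ [set t | forall i, `[0, 1]%classic (tnth t i)]) => //.
- exact: fock1.
- exact: (measurable_box (fun=> measurable_itv _)).
- by rewrite unit_box_measure lte01.
Qed.

End fock_moments.

(** * Adjoints of affine composition operators *)

Theorem theorem2p1 (R : realType) (n : nat) (hn : (0 < n)%N) (psi : R -> R)
  (hpsi : weight n psi)
  (C1 C2 : 'M[R[i]]_n) (D1 D2 : 'cV[R[i]]_n)
  (hC1 : opnorm C1 <= 1) (hC2 : opnorm C2 <= 1)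
  (hb1 : bounded_operator psi (comp_op (affine C1 D1)))
  (hb2 : bounded_operator psi (comp_op (affine C2 D2))) :
  is_adjoint psi (comp_op (affine C1 D1)) (comp_op (affine C2 D2)) <->
  [/\ D1 = 0, D2 = 0 & C1 ^t* = C2].
Proof.
have cpsi := weight_continuous hpsi; have growth := weight_linear_growth hpsi.
have f1 := fock1 cpsi growth (n := n).
have fc := fock_coord cpsi growth (n := n).
split=> [[_ _ adj]|[D10 D20 C12]]; last first.
  have affine0 (A : 'M[R[i]]_n) h : comp_op (affine A 0) h = fun z => h (A *m z).
    by apply/funext => z; rewrite /comp_op /affine /= addr0.
  split=> // f g ff fg; rewrite D10 D20 -C12 !affine0.
  apply: fock_dot_adjoint_matrix => // h fh.
    by case: hb1 => /(_ h fh) + _ _; rewrite D10 affine0.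
  by case: hb2 => /(_ h fh) + _ _; rewrite D20 -C12 affine0.
have k0 : fock_dot psi (fun _ : 'cV[R[i]]_n => 1) (fun=> 1) != 0.
  by apply/eqP => h; have := fock_dot1_gt0 cpsi growth (n := n); rewrite h ltxx.
have affine_fock (A : 'M[R[i]]_n) D j : bounded_operator psi (comp_op (affine A D)) ->
    fock psi (fun z => (A *m z + D) j 0).
  by case=> b _ _; exact: b _ (fc j).
(* <z_j o Gamma1, 1> = <z_j, 1> = 0, and the left side is (D1)_j <1, 1> *)
have D1E : D1 = 0.
  apply/matrixP => j o; rewrite (ord1 o) [RHS]mxE.
  have := adj _ _ (fc j) f1.
  rewrite [LHS](fock_dot_affine cpsi growth C1 D1 j f1) [RHS](fock_dot_coord1 cpsi growth).
  rewrite big1 ?add0r; last by move=> k _; rewrite (fock_dot_coord1 cpsi growth) mulr0.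
  by move=> /eqP; rewrite mulf_eq0 (negPf k0) orbF => /eqP.
(* 0 = <1, z_j> = <1, z_j o Gamma2>, the conjugate of (D2)_j <1, 1> *)
have D2E : D2 = 0.
  apply/matrixP => j o; rewrite (ord1 o) [RHS]mxE.
  have := adj _ _ f1 (fc j).
  rewrite -[RHS](fock_dotJ cpsi (affine_fock _ _ j hb2) f1).
  rewrite (fock_dot_affine cpsi growth C2 D2 j f1) -[LHS](fock_dotJ cpsi (fc j) f1).
  rewrite (fock_dot_coord1 cpsi growth) big1 ?add0r; last first.
    by move=> k _; rewrite (fock_dot_coord1 cpsi growth) mulr0.
  move=> /(can_inj (@conjCK _)) /esym/eqP.
  by rewrite mulf_eq0 (negPf k0) orbF => /eqP.
split=> //; apply/matrixP => j i; rewrite !mxE.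
(* <z_i o Gamma1, z_j> = (C1)_ij <z_j, z_j>, while <z_i, z_j o Gamma2> is the
   conjugate of (C2)_ji times <z_i, z_i> = <z_j, z_j> *)
have := adj _ _ (fc i) (fc j).
have expand (A : 'M[R[i]]_n) D k l : fock_dot psi (fun z => (A *m z + D) k 0) (fun z => z l 0) =
    A k l * fock_dot psi (fun z : 'cV[R[i]]_n => z l 0) (fun z => z l 0).
  rewrite (fock_dot_affine cpsi growth A D k (fc l)).
  rewrite -(fock_dotJ cpsi (fc l) f1) (fock_dot_coord1 cpsi growth) rmorph0 mulr0 addr0.
  rewrite (bigD1 l)//= big1 ?addr0// => h hl.
  by rewrite (fock_dot_coord_neq cpsi growth hl) mulr0.
rewrite [LHS](expand C1 D1 i j) -[RHS](fock_dotJ cpsi (affine_fock _ _ j hb2) (fc i)).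
rewrite (expand C2 D2 j i) rmorphM /= (fock_dotJ cpsi (fc i) (fc i)).
rewrite (fock_dot_coord_eq cpsi i j) => h.
have c0 : fock_dot psi (fun z : 'cV[R[i]]_n => z j 0) (fun z => z j 0) != 0.
  by apply/eqP => E; have := fock_dot_coord_gt0 cpsi growth j; rewrite E ltxx.
by rewrite (mulIf c0 h) conjCK.
Qed.
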